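(* Let $a:\mathbb{Z}\to\{z\in\mathbb{C}: |z|\le 1\}$, and for integers $j\ge 0$ put $\mu_j:=\sum_{2^{j-1}<n\le 2^j}\frac{a(n)}{n}\delta_n$. Suppose that there are constants $\epsilon>0$, $C\ge 1$ and $A<\infty$ such that $$|\mu_j*\tilde\mu_j(x)|\le A\,2^{-(1+\epsilon)j}\quad\text{for all integers } j>C \text{ and all } x\in\mathbb{Z}\setminus\{0\},$$ $$\|\mu_j*\tilde\mu_k\|_{\ell^\infty(\mathbb{Z})}\le A\,2^{-\epsilon k-j}\quad\text{for all integers } k>C \text{ and } j\ge k+C.$$ Let $$\mathcal{H}_a^{\mathbb{Z},*}f(x):=\sup_{N\ge 1}\Bigl|\sum_{n=N}^\infty\frac{a(n)}{n}f(x-n)\Bigr|.$$ Then there is a constant $C'<\infty$, independent of $r$, such that $$\|\mathcal{H}_a^{\mathbb{Z},*}:(1,r)\|\le \frac{C'}{r-1}\qquad\text{for all } 1<r<2.$$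
   Context: Functions on $\mathbb{Z}$ are complex valued; $\langle f,g\rangle=\sum_{x\in\mathbb{Z}}f(x)\overline{g(x)}$; $\delta_n$ is the point mass at $n$, measures on $\mathbb{Z}$ are identified with functions, and $*$ is convolution on $\mathbb{Z}$. For a function $g$ on $\mathbb{Z}$, $\tilde g(x):=\overline{g(-x)}$. An interval in $\mathbb{Z}$ is a (nonempty) set $I=[\alpha,\beta]\cap\mathbb{Z}$ with $\alpha,\beta\in\mathbb{R}$, and $|I|$ is its cardinality. For $r\ge1$, $\langle f\rangle_{I,r}:=\bigl(\frac1{|I|}\sum_{x\in I}|f(x)|^r\bigr)^{1/r}$. A collection $\mathcal{S}$ of intervals is sparse if for every $S\in\mathcal{S}$ there is a set $E_S\subset S$ such that the sets $\{E_S:S\in\mathcal{S}\}$ are pairwise disjoint and $|E_S|\ge\frac14|S|$ for all $S\in\mathcal{S}$. For $1\le r,s<\infty$ put $\Lambda_{\mathcal{S},r,s}(f,g):=\sum_{S\in\mathcal{S}}|S|\langle f\rangle_{S,r}\langle g\rangle_{S,s}$. For a (sub)linear operator $T$, $\|T:(r,s)\|$ denotes the smallest constant $B$ such that for all finitely supported $f,g$ on $\mathbb{Z}$, $|\langle Tf,g\rangle|\le B\sup_{\mathcal{S}}\Lambda_{\mathcal{S},r,s}(f,g)$, the supremum being over all sparse collections $\mathcal{S}$. *)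

(* Defs.v *)
From mathcomp Require Import all_boot all_order all_algebra finmap complex.
From mathcomp Require Import all_classical all_reals all_analysis.

Set Implicit Arguments.
Unset Strict Implicit.
Unset Printing Implicit Defensive.

Import Order.TTheory GRing.Theory Num.Theory.
Import numFieldNormedType.Exports.

Local Open Scope classical_set_scope.
Local Open Scope ring_scope.
Local Open Scope complex_scope.

(* The norm `|z| of z : R[i] is itself an element of R[i]; Normc.normc is the
   real-valued modulus. *)
Definition cmod (R : realType) (z : R[i]) : R := Normc.normc z.

Definition fin_supp (R : realType) (f : int -> R[i]) : Prop :=
  finite_set [set x | f x != 0].

(* A sum over [set: int] is the sum over the support of the summand when this
   support is finite, and 0 otherwise; pairing is meant for g (or f) finitely
   supported, and convol for f (or g) finitely supported. *)
Definition pairing (R : realType) (f g : int -> R[i]) : R[i] :=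
  \sum_(x \in [set: int]) f x * (g x)^*.

Definition convol (R : realType) (f g : int -> R[i]) : int -> R[i] :=
  fun x => \sum_(y \in [set: int]) f y * g (x - y).

Definition tilde (R : realType) (g : int -> R[i]) : int -> R[i] :=
  fun x => (g (- x))^*.

Definition linfty_norm (R : realType) (f : int -> R[i]) : \bar R :=
  ereal_sup [set (cmod (f x))%:E | x in [set: int]].

Definition delta (R : realType) (n : int) : int -> R[i] :=
  fun x => (x == n)%:R.

(* The condition 2 ^ (j - 1) < n is written 2 ^ j < 2 * n, which avoids a
   negative exponent for j = 0. *)
Definition mu (R : realType) (a : int -> R[i]) (j : nat) : int -> R[i] :=
  fun x => \sum_(0 <= n < (2 ^ j).+1 | (2 ^ j < 2 * n)%N)
             a n%:Z / n%:R * delta R n%:Z x.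

Definition zcard (I : set int) : nat := #|` fset_set I|.

Definition zinterval (R : realType) (I : set int) : Prop :=
  I !=set0 /\ exists alpha beta : R, I = [set x | alpha <= x%:~R <= beta].

Definition sparse (R : realType) (SS : set (set int)) : Prop :=
  (forall S, SS S -> zinterval R S) /\
  exists E : set int -> set int,
    [/\ forall S, SS S -> E S `<=` S,
        trivIset SS E &
        forall S, SS S -> (4^-1 * (zcard S)%:R <= (zcard (E S))%:R :> R)].

Definition avg (R : realType) (f : int -> R[i]) (I : set int) (r : R) : R :=
  ((zcard I)%:R^-1 * \sum_(x \in I) cmod (f x) `^ r) `^ r^-1.

Definition sparse_form (R : realType) (SS : set (set int)) (r s : R)
    (f g : int -> R[i]) : \bar R :=
  \esum_(S in SS) ((zcard S)%:R * avg f S r * avg g S s)%:E.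

(* This is +oo when no finite constant B is admissible. *)
Definition sparse_norm (R : realType)
    (T : (int -> R[i]) -> int -> R[i]) (r s : R) : \bar R :=
  ereal_inf [set B%:E | B in [set B : R |
    forall f g : int -> R[i], fin_supp f -> fin_supp g ->
      ((cmod (pairing (T f) g))%:E <=
       B%:E * ereal_sup [set sparse_form SS r s f g | SS in sparse R])%E]].

(* The topology on the complex numbers is carried by the alias R[i]^o. *)
Definition tail_sum (R : realType) (a f : int -> R[i]) (x : int) (N : nat) : R[i] :=
  limn (fun M : nat => \sum_(N <= n < M) (a n%:Z / n%:R * f (x - n%:Z))
                       : R[i]^o).

(* The set below is bounded when f is finitely supported (the case tested by
   sparse_norm) and a is bounded, so that sup is the actual supremum. *)
Definition Hmax (R : realType) (a f : int -> R[i]) : int -> R[i] :=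
  fun x => (sup [set cmod (tail_sum a f x N) | N in [set N | (1 <= N)%N]])%:C.

(* Main.v *)
(** Write [T_j f = mu_j * f]. Up to the Hardy-Littlewood maximal function, the
maximal truncation is [sup_k |sum_(j >= k) T_j f|]. Splitting the points [y]
according to the position of [[y, y + 2 ^ j]] in two shifted dyadic grids
localizes each [T_j] to dyadic cells of length [2 ^ (j + 3)], so everything
happens inside one nested grid, and a stopping-time recursion builds the sparse
family: in a cell [I] with averages [lam] of [|f|] and [G ^ r] of [|g| ^ r], the
children are the maximal cells on which one of these averages exceeds 4 times its
value on [I].

The part of the operator acting above the stopped cells is decomposed according
to [t], where a stopped cell of length [2 ^ s] is seen by [T_j] with
[j + 3 = s + t]. For fixed [t] the absolute values already give the bound
[O(lam G |I|)], which is enough for finitely many [t]. For large [t] the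
hypotheses on [mu_j * ~mu_k] make the pieces almost orthogonal, with a gain
[2 ^ (- c t)]. To pass to the supremum over truncations, index the active cells
by their generation (the number of active cells above) instead of by their
scale: since every active cell contains a stopped cell [2 ^ t] times shorter, the
generations beyond [2 ^ (2 t)] carry a proportion at most [2 ^ (- t)] of the mass,
and on the others the Rademacher-Menshov inequality loses only [O(t ^ 2)].
Splitting [g] at height [2 ^ (c t / 4) G] yields terms of size [2 ^ (- c' (r - 1) t)],
whose sum is [O(1 / (r - 1))]. *)

Require Import Defs.
From mathcomp Require Import all_boot all_order all_algebra finmap complex.
From mathcomp Require Import all_classical all_reals all_analysis.
From mathcomp Require Import zify ring lra.

Set Implicit Arguments.
Unset Strict Implicit.
Unset Printing Implicit Defensive.

Import Order.TTheory GRing.Theory Num.Theory.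
Import numFieldNormedType.Exports.

Local Open Scope ring_scope.

(** * The modulus of complex numbers *)

Section Modulus.
Variable R : realType.
Implicit Types z u v : R[i].

Lemma cmodE z : (cmod z)%:C%C = `|z|.
Proof. by rewrite normc_def; case: z => x y; rewrite /cmod /Normc.normc. Qed.

Lemma cmod_ge0 z : 0 <= cmod z.
Proof. by rewrite -lecR cmodE; exact: normr_ge0. Qed.

Lemma cmod0 : cmod (0 : R[i]) = 0.
Proof. by apply: (@complexI R); rewrite cmodE normr0. Qed.

Lemma cmodM z u : cmod (z * u) = cmod z * cmod u.
Proof. by apply: (@complexI R); rewrite cmodE normrM rmorphM. Qed.

Lemma cmodD z u : cmod (z + u) <= cmod z + cmod u.
Proof. by rewrite -lecR rmorphD /= !cmodE; exact: ler_normD. Qed.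

Lemma cmod_conj z : cmod z^*%C = cmod z.
Proof. by case: z => x y; rewrite /cmod /Normc.normc /= sqrrN. Qed.

Lemma cmod_conjM z : z * z^*%C = ((cmod z) ^+ 2)%:C%C.
Proof. by rewrite rmorphXn /= cmodE sqr_normc. Qed.

Lemma cmod_sum (I : Type) (s : seq I) (P : pred I) (F : I -> R[i]) :
  cmod (\sum_(i <- s | P i) F i) <= \sum_(i <- s | P i) cmod (F i).
Proof.
elim/big_ind2 : _ => [|x1 x2 y1 y2 h1 h2|//]; first by rewrite cmod0.
exact: le_trans (cmodD _ _) (lerD h1 h2).
Qed.

Lemma cmod_nat (n : nat) : cmod (n%:R : R[i]) = n%:R.
Proof.
by apply: (@complexI R); rewrite cmodE normr_nat rmorph_nat.
Qed.

Lemma cmodV z : cmod z^-1 = (cmod z)^-1.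
Proof. by apply: (@complexI R); rewrite cmodE normfV fmorphV. Qed.

Lemma cmod_real (x : R) : 0 <= x -> cmod (x%:C%C) = x.
Proof. by move=> x0; apply: (@complexI R); rewrite cmodE ger0_norm // lecR. Qed.

End Modulus.

(** * The Rademacher-Menshov inequality *)

(** Induction on dyadic blocks: beyond the midpoint, an increment is the one over the first half
    plus an increment inside the second half, so each doubling of the length adds one term to the
    majorant. The weights [wt], additive over intervals, stand in for orthogonality of the
    increments. *)
Lemma rademacher_menshov (R : realType) (X : finType) (S : nat -> X -> R[i])
    (wt : nat -> R) :
  (forall a b : nat, (a <= b)%N ->
     \sum_x cmod (S b x - S a x) ^+ 2 <= \sum_(a <= i < b) wt i) ->
  forall n a : nat, exists D : X -> R,
    [/\ forall x, 0 <= D x,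
        forall (m : nat) x, (m <= 2 ^ n)%N -> cmod (S (a + m)%N x - S a x) <= D x &
        \sum_x D x ^+ 2 <= n.+1%:R ^+ 2 * \sum_(a <= i < a + 2 ^ n) wt i].
Proof.
move=> hS; elim=> [|n IH] a.
  exists (fun x => cmod (S (a + 1)%N x - S a x)); split.
  - by move=> x; exact: cmod_ge0.
  - move=> [|[|m]] x //; first by rewrite addn0 subrr cmod0 cmod_ge0.
  - by rewrite expr1n mul1r; apply: hS; lia.
have [D1 [D1_ge0 D1_max D1_sum]] := IH a.
have [D2 [D2_ge0 D2_max D2_sum]] := IH (a + 2 ^ n)%N.
pose d x := cmod (S (a + 2 ^ n)%N x - S a x).
exists (fun x => d x + Num.max (D1 x) (D2 x)).
have d_ge0 x : 0 <= d x by exact: cmod_ge0.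
split.
- by move=> x; rewrite addr_ge0 // le_max D1_ge0.
- move=> m x hm; have [h|h] := leqP m (2 ^ n).
    apply: le_trans (D1_max _ _ h) _.
    by rewrite -[leLHS]add0r lerD // le_max lexx.
  have -> : (a + m = a + 2 ^ n + (m - 2 ^ n))%N by lia.
  have -> : S (a + 2 ^ n + (m - 2 ^ n))%N x - S a x =
    S (a + 2 ^ n)%N x - S a x +
    (S (a + 2 ^ n + (m - 2 ^ n))%N x - S (a + 2 ^ n)%N x) by ring.
  apply: le_trans (cmodD _ _) _; rewrite lerD //.
  by rewrite le_max D2_max ?orbT //; rewrite expnS in hm; lia.
- have -> : (a + 2 ^ n.+1 = a + 2 ^ n + 2 ^ n)%N by rewrite expnS; lia.
  rewrite (@big_cat_nat _ _ _ (a + 2 ^ n)%N) /=; [|lia|lia].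
  set w1 := \sum_(_ <= i < a + 2 ^ n) _ in D1_sum *.
  set w2 := \sum_(_ <= i < a + 2 ^ n + 2 ^ n) _ in D2_sum *.
  have dsum : \sum_x d x ^+ 2 <= w1 by apply: hS; lia.
  have w2_ge0 : 0 <= w2.
    apply: le_trans (hS _ _ _); last by lia.
    by apply: sumr_ge0 => x _; exact: sqr_ge0.
  have n1 : 0 < n.+1%:R :> R by rewrite ltr0n.
  (* weighted Cauchy-Schwarz [(u+v)^2 <= (n+2) u^2 + (n+2)/(n+1) v^2] *)
  apply: (@le_trans _ _ (\sum_x ((n.+2)%:R * d x ^+ 2 +
      (n.+2)%:R / n.+1%:R * (D1 x ^+ 2 + D2 x ^+ 2)))).
    apply: ler_sum => x _.
    have hmax : Num.max (D1 x) (D2 x) ^+ 2 <= D1 x ^+ 2 + D2 x ^+ 2.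
      by rewrite maxEle; case: ifP => _; rewrite ?lerDl ?lerDr sqr_ge0.
    apply: (@le_trans _ _ ((n.+2)%:R * d x ^+ 2 +
      (n.+2)%:R / n.+1%:R * Num.max (D1 x) (D2 x) ^+ 2)); last first.
      by rewrite lerD2l ler_wpM2l // divr_ge0.
    move: (Num.max _ _) => v; rewrite -subr_ge0.
    have -> : n.+2%:R = n.+1%:R + 1 :> R by rewrite -natr1.
    have -> : (n.+1%:R + 1) * d x ^+ 2 + (n.+1%:R + 1) / n.+1%:R * v ^+ 2
      - (d x + v) ^+ 2 = (n.+1%:R * d x - v) ^+ 2 / n.+1%:R.
      by field; rewrite gt_eqF.
    by rewrite divr_ge0 ?sqr_ge0 // ltW.
  rewrite big_split /= -!mulr_sumr big_split /=.
  apply: (@le_trans _ _ (n.+2%:R * w1 +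
     n.+2%:R / n.+1%:R * (n.+1%:R ^+ 2 * w1 + n.+1%:R ^+ 2 * w2))).
    by rewrite lerD ?ler_wpM2l ?divr_ge0 ?lerD.
  have -> : n.+2%:R = n.+1%:R + 1 :> R by rewrite -natr1.
  rewrite -subr_ge0.
  have -> : (n.+1%:R + 1) ^+ 2 * (w1 + w2) - ((n.+1%:R + 1) * w1 +
    (n.+1%:R + 1) / n.+1%:R * (n.+1%:R ^+ 2 * w1 + n.+1%:R ^+ 2 * w2)) =
     (n.+1%:R + 1) * w2.
    by field; rewrite gt_eqF.
  by rewrite mulr_ge0 // addr_ge0.
Qed.

(** * Almost orthogonality *)

(* Cells of level [p] are the fibers of [lab p]; the window [X] is finite. *)
Section Kernel.
Variables (R : realType) (X : finType) (lab : nat -> X -> nat) (q : nat).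
Hypothesis lab_nest : forall p p' x y,
  (p <= p')%N -> lab p x = lab p y -> lab p' x = lab p' y.
Hypothesis lab_card : forall p x, (p <= q)%N ->
  \sum_(y | lab p y == lab p x) 1 = 2 ^+ p :> R.
Variable K : nat -> X -> X -> R[i].
Hypothesis K_size : forall j x y, (j + 3 <= q)%N -> cmod (K j x y) <= 2 / 2 ^+ j.
Hypothesis K_supp : forall j x y, (j + 3 <= q)%N -> K j x y != 0 ->
  lab (j + 3)%N x = lab (j + 3)%N y.

Lemma pow2_gt0 p : 0 < 2 ^+ p :> R.
Proof. by rewrite exprn_gt0. Qed.

(** Sum in [x] first: the column at [y] has height [2 / 2 ^ j] on a cell of length [8 * 2 ^ j],
    where [hh] has density at most [c]; whence [16 c]. Each [y] carries its own scale [jj y]. *)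
Lemma absolute_bound (Y : pred X) (jj : X -> nat) (w hh : X -> R) (c : R) :
  (forall y, Y y -> (jj y + 3 <= q)%N) ->
  (forall y, 0 <= w y) -> (forall x, 0 <= hh x) ->
  (forall y, Y y ->
    \sum_(x | lab (jj y + 3)%N x == lab (jj y + 3)%N y) hh x <= c * 2 ^+ (jj y + 3)) ->
  \sum_x hh x * (\sum_(y | Y y) cmod (K (jj y) x y) * w y) <=
    16 * c * \sum_(y | Y y) w y.
Proof.
move=> Yq w0 h0 hc.
under eq_bigr do rewrite mulr_sumr.
rewrite exchange_big /= mulr_sumr; apply: ler_sum => y Yy.
apply: (@le_trans _ _ (\sum_(x | lab (jj y + 3)%N x == lab (jj y + 3)%N y)
   (hh x * (2 / 2 ^+ jj y * w y)))).
  rewrite [leRHS]big_mkcond /=; apply: ler_sum => x _.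
  case: ifPn => [_|nl].
    by rewrite ler_wpM2l // ler_wpM2r // K_size // Yq.
  have -> : K (jj y) x y = 0.
    by apply/eqP; apply: contraNT nl => /(K_supp (Yq _ Yy)) ->.
  by rewrite cmod0 mul0r mulr0.
rewrite -mulr_suml mulrA.
rewrite ler_wpM2r //.
apply: le_trans (ler_wpM2r _ (hc _ Yy)) _.
  by rewrite divr_ge0 // ltW // pow2_gt0.
have := pow2_gt0 (jj y); set u := 2 ^+ jj y => u0.
rewrite exprD -/u (_ : 2 ^+ 3 = 8 :> R); last by ring.
by rewrite (_ : c * (u * 8) * (2 / u) = 16 * c) //; field; rewrite gt_eqF.
Qed.

(** Inner product of two columns, that is, an entry of the matrix of [T_k^* T_j]. *)
Definition gram j y k y' := \sum_x K j x y * (K k x y')^*%C.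

Lemma gramC j y k y' : cmod (gram j y k y') = cmod (gram k y' j y).
Proof.
rewrite -[LHS]cmod_conj /gram raddf_sum /=; congr cmod.
by apply: eq_bigr => x _; rewrite rmorphM /= conjcK mulrC.
Qed.

Lemma gram_diag j y : (j + 3 <= q)%N -> cmod (gram j y j y) <= 32 / 2 ^+ j.
Proof.
move=> jq; apply: le_trans (cmod_sum _ _ _) _.
have u0 := pow2_gt0 j.
apply: (@le_trans _ _ (\sum_(x | lab (j + 3)%N x == lab (j + 3)%N y)
   (4 / (2 ^+ j) ^+ 2 * 1))).
  rewrite [leRHS]big_mkcond /=; apply: ler_sum => x _.
  rewrite cmodM cmod_conj.
  case: ifPn => [_|nl].
    have -> : 4 / (2 ^+ j) ^+ 2 * 1 = 2 / 2 ^+ j * (2 / 2 ^+ j) :> R.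
      by field; rewrite gt_eqF.
    by rewrite ler_pM ?cmod_ge0 ?K_size.
  have -> : K j x y = 0.
    by apply/eqP; apply: contraNT nl => /(K_supp jq) ->.
  by rewrite cmod0 mul0r.
rewrite -mulr_sumr lab_card // exprD (_ : 2 ^+ 3 = 8 :> R); last by ring.
rewrite le_eqVlt; apply/orP; left; apply/eqP.
by field; rewrite gt_eqF.
Qed.

Lemma gram_supp j y k y' : (k <= j)%N -> (j + 3 <= q)%N ->
  lab (j + 3)%N y' != lab (j + 3)%N y -> gram j y k y' = 0.
Proof.
move=> kj jq nl; apply: big1 => x _; apply/eqP.
rewrite mulf_eq0 conjc_eq0; apply: contraNT nl; rewrite negb_or => /andP[h1 h2].
rewrite -(K_supp _ h1) // eq_sym; apply/eqP.
by apply: (@lab_nest (k + 3)%N); [lia|apply: K_supp h2; lia].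
Qed.

(** Expand the square into Gram entries. By symmetry the off-diagonal pairs with [jj y' <= jj y]
    suffice, up to a factor 2; by [gram_supp] such [y'] lie in the cell of level [jj y + 3] of [y],
    whose mass [a2 * 2 ^ j] cancels the decay [e / 2 ^ j]. On the diagonal, [a1 * 2 ^ j] meets
    [gram_diag]. *)
Lemma almost_orthogonality (Y : pred X) (jj : X -> nat) (f : X -> R[i]) (a1 a2 e : R) :
  (forall y, Y y -> (jj y + 3 <= q)%N) -> 0 <= e ->
  (forall y, Y y -> cmod (f y) <= a1 * 2 ^+ jj y) ->
  (forall y, Y y -> \sum_(y' | Y y' && (lab (jj y + 3)%N y' == lab (jj y + 3)%N y))
      cmod (f y') <= a2 * 2 ^+ jj y) ->
  (forall y y', Y y -> Y y' -> (jj y' <= jj y)%N -> y != y' ->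
     cmod (gram (jj y) y (jj y') y') <= e / 2 ^+ jj y) ->
  \sum_x cmod (\sum_(y | Y y) K (jj y) x y * f y) ^+ 2 <=
    (32 * a1 + 2 * e * a2) * \sum_(y | Y y) cmod (f y).
Proof.
move=> Yq e0 h1 h2 h3.
pose c y y' := cmod (f y) * cmod (f y') * cmod (gram (jj y) y (jj y') y').
have c_ge0 y y' : 0 <= c y y' by rewrite /c !mulr_ge0 ?cmod_ge0.
have cC y y' : c y y' = c y' y by rewrite /c gramC [cmod (f y) * _]mulrC.
have step1 : \sum_x cmod (\sum_(y | Y y) K (jj y) x y * f y) ^+ 2 <=
    \sum_(y | Y y) \sum_(y' | Y y') c y y'.
  have S0 : 0 <= \sum_x cmod (\sum_(y | Y y) K (jj y) x y * f y) ^+ 2.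
    by apply: sumr_ge0 => x _; exact: sqr_ge0.
  (* The real sum is cast to complex numbers, where each square expands as a product with the
     conjugate. *)
  rewrite -[leLHS](cmod_real S0) rmorph_sum /=.
  have -> : \sum_x ((cmod (\sum_(y | Y y) K (jj y) x y * f y)) ^+ 2)%:C%C =
      \sum_(y | Y y) \sum_(y' | Y y')
        (f y * (f y')^*%C) * gram (jj y) y (jj y') y'.
    transitivity (\sum_x \sum_(y | Y y) \sum_(y' | Y y')
        (K (jj y) x y * f y) * (K (jj y') x y' * f y')^*%C).
      apply: eq_bigr => x _.
      rewrite -cmod_conjM (raddf_sum (@conjc R)) /= mulr_suml.
      by apply: eq_bigr => y _; rewrite mulr_sumr.
    rewrite exchange_big; apply: eq_bigr => y _ /=.
    rewrite exchange_big; apply: eq_bigr => y' _ /=.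
    rewrite /gram mulr_sumr; apply: eq_bigr => x _.
    by rewrite rmorphM /=; ring.
  apply: le_trans (cmod_sum _ _ _) _; apply: ler_sum => y _.
  apply: le_trans (cmod_sum _ _ _) _; apply: ler_sum => y' _.
  by rewrite !cmodM cmod_conj.
apply: le_trans step1 _.
pose lo y := \sum_(y' | Y y' && (y != y') && (jj y' <= jj y)%N) c y y'.
have step2 : \sum_(y | Y y) \sum_(y' | Y y') c y y' <=
    \sum_(y | Y y) (c y y + 2 * lo y).
  rewrite big_split /= -mulr_sumr mulr_natl mulr2n.
  have -> : \sum_(y | Y y) \sum_(y' | Y y') c y y' =
     \sum_(y | Y y) c y y + \sum_(y | Y y) \sum_(y' | Y y' && (y != y')) c y y'.
    rewrite -big_split /=; apply: eq_bigr => y Yy.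
    rewrite (bigD1 y) //=; congr (_ + _).
    by apply: eq_bigl => y'; rewrite [y == y']eq_sym.
  rewrite lerD2l.
  have {2}-> : \sum_(y | Y y) lo y =
     \sum_(y | Y y) \sum_(y' | Y y' && (y != y') && (jj y <= jj y')%N) c y y'.
    rewrite /lo (exchange_big_dep Y) /= => [|y y' _ /andP[/andP[-> //]]].
    apply: eq_bigr => y Yy; apply: eq_big => [y'|y' _]; last exact: cC.
    by rewrite Yy [y == y']eq_sym andbA.
  rewrite -big_split /=; apply: ler_sum => y Yy.
  rewrite /lo (big_mkcond (fun i => _ && (jj i <= _)%N)).
  rewrite [X in _ <= _ + X]big_mkcond [leLHS]big_mkcond.
  rewrite -big_split /=; apply: ler_sum => y' _.
  case: (Y y' && (y != y')) => /=; last by rewrite addr0.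
  case: leqP => h; case: leqP => h' //; rewrite ?addr0 ?add0r ?lexx //.
  - by rewrite lerDl.
  - by lia.
apply: le_trans step2 _; rewrite mulr_sumr; apply: ler_sum => y Yy.
have u0 := pow2_gt0 (jj y).
have d : c y y <= 32 * a1 * cmod (f y).
  apply: (@le_trans _ _ (cmod (f y) * (a1 * 2 ^+ jj y) * (32 / 2 ^+ jj y))).
    by rewrite /c ler_pM ?mulr_ge0 ?cmod_ge0 ?gram_diag ?ler_wpM2l ?cmod_ge0 ?h1 // Yq.
  rewrite le_eqVlt; apply/orP; left; apply/eqP.
  by field; rewrite gt_eqF.
have l : lo y <= e * a2 * cmod (f y).
  apply: (@le_trans _ _ (cmod (f y) * (e / 2 ^+ jj y) *
     \sum_(y' | Y y' && (lab (jj y + 3)%N y' == lab (jj y + 3)%N y)) cmod (f y'))).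
    rewrite mulr_sumr /lo big_mkcond [leRHS]big_mkcond /=; apply: ler_sum => y' _.
    case Yy' : (Y y') => //=.
    have rhs0 : 0 <= cmod (f y) * (e / 2 ^+ jj y) * cmod (f y').
      by rewrite !mulr_ge0 ?cmod_ge0 // invr_ge0 ltW.
    case: ifPn => [/andP[yy' hj]|_]; last by case: ifP.
    case: ifPn => [_|nl].
      rewrite /c mulrAC ler_wpM2r ?cmod_ge0 // ler_wpM2l ?cmod_ge0 //.
      exact: h3.
    by rewrite /c gram_supp ?cmod0 ?mulr0 // Yq.
  apply: le_trans (ler_wpM2l _ (h2 _ Yy)) _.
    by rewrite !mulr_ge0 ?cmod_ge0 // invr_ge0 ltW.
  rewrite le_eqVlt; apply/orP; left; apply/eqP.
  by field; rewrite gt_eqF.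
have -> : (32 * a1 + 2 * e * a2) * cmod (f y) =
   32 * a1 * cmod (f y) + 2 * (e * a2 * cmod (f y)) by ring.
by rewrite lerD // ler_wpM2l.
Qed.

End Kernel.

(** * Generations of active cells *)

(* [s y] is the level of the stopped cell of [y]; the layer [Y] consists of
   points [y] that are acted upon by the kernel of scale [s y + t - 3] only,
   which lives on the cell of level [s y + t] of [y]. *)
Section Generations.
Variables (R : realType) (X : finType) (lab : nat -> X -> nat) (q : nat).
Hypothesis lab_nest : forall p p' x y,
  (p <= p')%N -> lab p x = lab p y -> lab p' x = lab p' y.
Hypothesis lab_card : forall p x, (p <= q)%N ->
  \sum_(y | lab p y == lab p x) 1 = 2 ^+ p :> R.
Variables (I : pred X) (s : X -> nat) (t : nat) (Y : pred X).
Hypothesis I_size : \sum_(x | I x) 1 = 2 ^+ q :> R.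
Hypothesis s_atom : forall x y, I x -> lab (s x) y = lab (s x) x -> s y = s x.
Hypothesis s_le : forall x, I x -> (s x <= q)%N.
Hypothesis YI : forall y, Y y -> I y.
Hypothesis Y_atom : forall y z, Y y -> lab (s y) z = lab (s y) y -> Y z.
Hypothesis Y_lev : forall y, Y y -> (3 <= s y + t <= q)%N.

Definition lev y := (s y + t)%N.
(** The truncated subtraction is exact on [Y], where [3 <= s y + t]. *)
Definition scale y := (s y + t - 3)%N.
Definition act p x := [exists y, [&& Y y, lev y == p & lab p y == lab p x]].
Definition gen p x := (\sum_(p.+1 <= p' < q.+1) act p' x)%N.

Lemma scaleK y : Y y -> (scale y + 3)%N = lev y.
Proof. by move=> /Y_lev; rewrite /scale /lev; lia. Qed.

Lemma act_lab p p' x y : (p <= p')%N -> lab p x = lab p y -> act p' x = act p' y.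
Proof. by move=> pp' /(lab_nest pp') e; rewrite /act e. Qed.

Lemma gen_lab p x y : lab p x = lab p y -> gen p x = gen p y.
Proof.
move=> e; rewrite /gen; apply: eq_big_nat => p' /andP[h _].
by rewrite (@act_lab p p' x y) //; lia.
Qed.

Lemma gen_anti p p' x : (p <= p')%N -> (gen p' x <= gen p x)%N.
Proof.
move=> pp'; rewrite /gen; have [h|h] := leqP p' q.
  by rewrite [leqRHS](@big_cat_nat _ _ _ p'.+1) //= leq_addl.
by rewrite big_geq //; lia.
Qed.

Lemma gen_lt p p' x : (p < p' <= q)%N -> act p' x -> (gen p' x < gen p x)%N.
Proof.
move=> /andP[pp' p'q] a; rewrite /gen [ltnRHS](@big_cat_nat _ _ _ p') //=; last by lia.
by rewrite [X in (_ < _ + X)%N]big_ltn ?ltnS // a /=; lia.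
Qed.

Lemma act_lev y x : Y y -> lab (lev y) y = lab (lev y) x -> act (lev y) x.
Proof. by move=> Yy e; apply/existsP; exists y; rewrite Yy eqxx e eqxx. Qed.

(** This trades a cut-off in scale for a cut-off in generation. The active cells around [x] form a
    chain, along which generations decrease as levels grow; [k <= scale y] reads [k + 2 < lev y].
    The new threshold depends on [x] and [k] only. *)
Lemma gen_scale y x k : Y y -> lab (lev y) y = lab (lev y) x ->
  (k <= scale y)%N = (gen (lev y) y < gen (k + 2) x)%N.
Proof.
move=> Yy e; rewrite (gen_lab e); have := scaleK Yy; have /andP[_ lq] := Y_lev Yy.
move=> hs; apply/idP/idP => h.
  by apply: gen_lt (act_lev Yy e); rewrite /lev; move: hs; rewrite /lev; lia.
rewrite leqNgt; apply/negP => h'; move: h; rewrite ltnNge gen_anti //.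
by move: hs; rewrite /lev; lia.
Qed.

(** The stopped cells partition [h]. Spreading each [w y] evenly over its stopped cell and
    exchanging the sums compares [w] with its means, without enumerating the cells. *)
Lemma atom_sum (w : X -> R) (c : R) (h : pred X) :
  (forall y, h y -> I y) ->
  (forall y z, h y -> lab (s y) z = lab (s y) y -> h z) ->
  (forall y, 0 <= w y) ->
  (forall x, I x -> \sum_(y | lab (s x) y == lab (s x) x) w y <= c * 2 ^+ s x) ->
  \sum_(y | h y) w y <= c * \sum_(y | h y) 1.
Proof.
move=> hI h_atom w0 hw.
have -> : \sum_(y | h y) w y =
    \sum_(y | h y) \sum_(z | lab (s y) z == lab (s y) y) (w y / 2 ^+ s y * 1).
  apply: eq_bigr => y hy; rewrite -mulr_sumr lab_card ?s_le ?hI //.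
  by rewrite mulfVK // gt_eqF // pow2_gt0.
rewrite (exchange_big_dep h) /=; last by move=> y z hy /eqP; exact: h_atom.
rewrite mulr_sumr; apply: ler_sum => z hz; rewrite mulr1.
apply: (@le_trans _ _ (\sum_(y | lab (s z) y == lab (s z) z) (2 ^+ s z)^-1 * w y)).
  rewrite big_mkcond [leRHS]big_mkcond /=; apply: ler_sum => y _.
  case: ifPn => [/andP[hy /eqP e]|_].
    have sE := s_atom (hI _ hy) e.
    by rewrite sE e eqxx mulr1 mulrC.
  by case: ifP => // _; rewrite mulr_ge0 // invr_ge0 ltW // pow2_gt0.
by rewrite -mulr_sumr ler_pdivrMl ?pow2_gt0 // mulrC hw // hI.
Qed.

(** Each active cell contains a whole stopped cell, whose points, weighted by [2 ^ (- s z)], have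
    total weight 1: this pays for the active cell at every [x] in it. Summing over [x], each [z]
    pays [2 ^ (lev z - s z) = 2 ^ t]. *)
Lemma act_count :
  \sum_(x | I x) (\sum_(0 <= p < q.+1) act p x)%:R <= 2 ^+ t * 2 ^+ q :> R.
Proof.
apply: (@le_trans _ _ (\sum_(x | I x)
   \sum_(z | Y z && (lab (lev z) z == lab (lev z) x)) (2 ^+ s z)^-1)).
  apply: ler_sum => x Ix; rewrite natr_sum.
  have -> : \sum_(z | Y z && (lab (lev z) z == lab (lev z) x)) (2 ^+ s z)^-1 =
     \sum_(0 <= p < q.+1)
       \sum_(z | [&& Y z, lev z == p & lab p z == lab p x]) (2 ^+ s z)^-1 :> R.
    rewrite (exchange_big_dep Y) /=; last by move=> p z _ /and3P[].
    rewrite big_mkcondr /=; apply: eq_bigr => z Yz.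
    rewrite (eq_bigl (fun p => (p == lev z) && (lab (lev z) z == lab (lev z) x))).
      have /andP[_ lq] := Y_lev Yz.
      by rewrite [RHS]big_mkcondr /= big_nat1_eq /= ltnS lq.
    move=> p /=; rewrite Yz /= [p == _]eq_sym.
    by case: eqP => //= ->.
  apply: ler_sum => p _.
  case a : (act p x) => /=; last first.
    by rewrite sumr_ge0 // => z _; rewrite invr_ge0 ltW // pow2_gt0.
  have /existsP[z0 /and3P[Yz0 /eqP lz0 /eqP e]] := a.
  apply: (@le_trans _ _ (\sum_(z | lab (s z0) z == lab (s z0) z0) ((2 ^+ s z0)^-1 * 1))).
    by rewrite -mulr_sumr lab_card ?s_le ?YI // mulVf // gt_eqF // pow2_gt0.
  rewrite big_mkcond [leRHS]big_mkcond /=; apply: ler_sum => z _.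
  case: ifPn => [/eqP ez|_].
    have sE := s_atom (YI Yz0) ez.
    rewrite (Y_atom Yz0 ez) /= /lev sE -/(lev z0) lz0 eqxx mulr1.
    rewrite (@lab_nest (s z0) p z z0) ?e ?eqxx //.
    by rewrite -lz0 /lev; lia.
  by case: ifP => // _; rewrite invr_ge0 ltW // pow2_gt0.
rewrite (exchange_big_dep Y) /=; last by move=> x z _ /andP[].
apply: (@le_trans _ _ (\sum_(z | Y z) 2 ^+ t)).
  apply: ler_sum => z Yz.
  apply: (@le_trans _ _ (\sum_(x | lab (lev z) x == lab (lev z) z) ((2 ^+ s z)^-1 * 1))).
    rewrite big_mkcond [leRHS]big_mkcond /=; apply: ler_sum => x _.
    rewrite mulr1 eq_sym; case: ifPn => [/and3P[_ _ ->] //|_].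
    by case: ifP => // _; rewrite invr_ge0 ltW // pow2_gt0.
  have /andP[_ lq] := Y_lev Yz.
  by rewrite -mulr_sumr lab_card // exprD mulKf // gt_eqF // pow2_gt0.
rewrite -[X in _ <= _ * X]I_size mulr_sumr big_mkcond [leRHS]big_mkcond /=.
apply: ler_sum => x _; rewrite mulr1; case: ifPn => [/YI -> //|_].
by case: ifP => // _; rewrite ltW // pow2_gt0.
Qed.

(** Chebyshev: a point counted here lies in at least [M] active cells, so [act_count] bounds the
    number of such points, and [atom_sum] converts that number into mass. *)
Lemma high_generation_mass (w : X -> R) (lam : R) (M : nat) :
  (forall y, 0 <= w y) -> 0 <= lam ->
  (forall x, I x -> \sum_(y | lab (s x) y == lab (s x) x) w y <= 8 * lam * 2 ^+ s x) ->
  M%:R * \sum_(y | Y y && (M <= gen (lev y) y)%N) w y <= 8 * lam * (2 ^+ t * 2 ^+ q).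
Proof.
move=> w0 lam0 hw.
have hs : \sum_(y | Y y && (M <= gen (lev y) y)%N) w y <=
   8 * lam * \sum_(y | Y y && (M <= gen (lev y) y)%N) 1.
  apply: atom_sum => // [y /andP[/YI] //|y z /andP[Yy hM] e].
  rewrite (Y_atom Yy e) /= /lev (s_atom (YI Yy) e) -/(lev y).
  by rewrite (@gen_lab _ z y) //; apply: lab_nest e; rewrite /lev; lia.
apply: le_trans (ler_wpM2l (ler0n _ _) hs) _.
rewrite mulrCA ler_wpM2l ?mulr_ge0 //.
apply: le_trans act_count.
rewrite mulr_sumr big_mkcond [leRHS]big_mkcond /=; apply: ler_sum => y _.
case: ifPn => [/andP[Yy hM]|_]; last by case: ifP.
rewrite (YI Yy) mulr1 ler_nat; apply: leq_trans hM _.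
rewrite /gen [leqRHS](@big_cat_nat _ _ _ (lev y).+1) //= ?leq_addl //.
by have := Y_lev Yy; rewrite /lev; lia.
Qed.

End Generations.

(** * Maximal truncations of one layer *)

Section Maximal.
Variables (R : realType) (X : finType) (lab : nat -> X -> nat) (q : nat).
Hypothesis lab_nest : forall p p' x y,
  (p <= p')%N -> lab p x = lab p y -> lab p' x = lab p' y.
Hypothesis lab_card : forall p x, (p <= q)%N ->
  \sum_(y | lab p y == lab p x) 1 = 2 ^+ p :> R.
Variable K : nat -> X -> X -> R[i].
Hypothesis K_size : forall j x y, (j + 3 <= q)%N -> cmod (K j x y) <= 2 / 2 ^+ j.
Hypothesis K_supp : forall j x y, (j + 3 <= q)%N -> K j x y != 0 ->
  lab (j + 3)%N x = lab (j + 3)%N y.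
Variables (I : pred X) (s : X -> nat) (t : nat) (Y : pred X).
Hypothesis I_size : \sum_(x | I x) 1 = 2 ^+ q :> R.
Hypothesis s_atom : forall x y, I x -> lab (s x) y = lab (s x) x -> s y = s x.
Hypothesis s_le : forall x, I x -> (s x <= q)%N.
Hypothesis YI : forall y, Y y -> I y.
Hypothesis Y_atom : forall y z, Y y -> lab (s y) z = lab (s y) y -> Y z.
Hypothesis Y_lev : forall y, Y y -> (3 <= s y + t <= q)%N.
Variables (f : X -> R[i]) (lam : R).
Let w y := cmod (f y).
Hypothesis lam_ge0 : 0 <= lam.
Hypothesis t_gt0 : (0 < t)%N.
Hypothesis w_total : \sum_(x | I x) w x <= lam * 2 ^+ q.
Hypothesis w_atom : forall x, I x ->
  \sum_(y | lab (s x) y == lab (s x) x) w y <= 8 * lam * 2 ^+ s x.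
Hypothesis w_good : forall p x, I x -> (s x < p <= q)%N ->
  \sum_(y | lab p y == lab p x) w y <= 4 * lam * 2 ^+ p.

Local Notation jj := (scale s t).
Local Notation lv := (lev s t).

(** With absolute values inside, it majorizes all truncations of the layer at once. *)
Definition layer_max (x : X) := \sum_(y | Y y) cmod (K (jj y) x y) * w y.

Lemma sum_Y_le : \sum_(y | Y y) w y <= lam * 2 ^+ q.
Proof.
apply: le_trans w_total; rewrite big_mkcond [leRHS]big_mkcond /=.
by apply: ler_sum => y _; case: ifPn => [/YI -> //|_]; case: ifP => // _; exact: cmod_ge0.
Qed.

Lemma jj_q y : Y y -> (jj y + 3 <= q)%N.
Proof. by move=> Yy; rewrite (scaleK Y_lev Yy); have /andP[] := Y_lev Yy. Qed.

Lemma layer_abs (hh : X -> R) (c : R) :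
  0 <= c -> (forall x, 0 <= hh x) ->
  (forall p x, I x -> (s x < p <= q)%N ->
     \sum_(y | lab p y == lab p x) hh y <= c * 2 ^+ p) ->
  \sum_(x | I x) hh x * layer_max x <= 16 * c * (lam * 2 ^+ q).
Proof.
move=> c0 h0 hc.
apply: (@le_trans _ _ (\sum_x hh x * layer_max x)).
  rewrite [leLHS]big_mkcond /=; apply: ler_sum => x _; case: ifP => // _.
  by rewrite mulr_ge0 // sumr_ge0 // => y _; rewrite mulr_ge0 ?cmod_ge0.
apply: le_trans (absolute_bound (lab := lab) (q := q) (c := c) K_size K_supp _ _ _ _) _ => //.
- exact: jj_q.
- by move=> y; exact: cmod_ge0.
- move=> y Yy; apply: hc; first exact: YI.
  rewrite (scaleK Y_lev Yy) /lev; have := Y_lev Yy; lia.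
- by rewrite ler_wpM2l ?sum_Y_le // mulr_ge0.
Qed.

(* Truncating at scale [k] amounts to keeping the generations below some [m]
   depending on [x] and [k]; [tau] is the free parameter of AM-GM. *)
Lemma layer_maximal (e tau : R) :
  0 <= e -> 0 < tau ->
  (forall y y', Y y -> Y y' -> (jj y' <= jj y)%N -> y != y' ->
     cmod (gram K (jj y) y (jj y') y') <= e / 2 ^+ jj y) ->
  exists V : X -> R,
    [/\ forall x, 0 <= V x,
        forall x k, cmod (\sum_(y | Y y && (k <= jj y)%N) K (jj y) x y * f y) <= V x,
        forall x, V x <= layer_max x &
        \sum_(x | I x) V x <=
         ((2 * t).+1%:R ^+ 2 * ((2048 * lam / 2 ^+ t + 64 * e * lam) * (lam * 2 ^+ q)) / tau
          + tau * 2 ^+ q) / 2 + 128 * (lam * 2 ^+ q) / 2 ^+ t].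
Proof.
move=> e0 tau0 hgram.
have w0 y : 0 <= w y by exact: cmod_ge0.
pose ge y := gen lab q s t Y (lv y) y.
pose S m x := \sum_(y | Y y && (ge y < m)%N) K (jj y) x y * f y.
set X0 := 2048 * lam / 2 ^+ t + 64 * e * lam.
have orth (A : pred X) : (forall y, A y -> Y y) ->
   \sum_x cmod (\sum_(y | A y) K (jj y) x y * f y) ^+ 2 <= X0 * \sum_(y | A y) w y.
  move=> AY.
  (* [a1]: a point has at most the mass of its stopped cell, and [2 ^ s = 8 * 2 ^ j / 2 ^ t]. [a2]:
     since [0 < t], the cell of level [lev y] is strictly above the stopped one, so its mean is at
     most [4 lam]. *)
  have -> : X0 = 32 * (64 * lam / 2 ^+ t) + 2 * e * (32 * lam) by rewrite /X0; ring.
  apply: (almost_orthogonality (lab := lab) (q := q)) => //.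
  - by move=> y /AY; exact: jj_q.
  - move=> y /AY Yy; apply: le_trans (_ : w y <= \sum_(y' | lab (s y) y' == lab (s y) y) w y') _.
      by rewrite (bigD1 y) //= lerDl sumr_ge0.
    apply: le_trans (w_atom (YI Yy)) _.
    have := scaleK Y_lev Yy; rewrite /lev => h.
    have : 2 ^+ (jj y + 3) = 2 ^+ (s y + t) :> R by rewrite h.
    rewrite !exprD (_ : 2 ^+ 3 = 8 :> R); last by ring.
    have := pow2_gt0 R t; set u := 2 ^+ t => u0 h'.
    have -> : 2 ^+ s y = 2 ^+ jj y * 8 / u by rewrite h' mulfK // gt_eqF.
    rewrite le_eqVlt; apply/orP; left; apply/eqP; field; by rewrite gt_eqF.
  - move=> y /AY Yy; apply: (@le_trans _ _ (\sum_(y' | lab (lv y) y' == lab (lv y) y) w y')).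
      rewrite (scaleK Y_lev Yy) big_mkcond [leRHS]big_mkcond /=; apply: ler_sum => y' _.
      by case: (A y') => //=; case: ifP.
    have h := Y_lev Yy.
    apply: le_trans (w_good (YI Yy) _) _; first by rewrite /lev; lia.
    rewrite -(scaleK Y_lev Yy) exprD (_ : 2 ^+ 3 = 8 :> R); last by ring.
    by rewrite le_eqVlt; apply/orP; left; apply/eqP; ring.
  - by move=> y y' /AY Yy /AY Yy'; exact: hgram.
have X00 : 0 <= X0.
  have h1 : 0 <= lam / 2 ^+ t by rewrite divr_ge0 // ltW // pow2_gt0.
  by have h2 := mulr_ge0 e0 lam_ge0; rewrite /X0; lra.
have Smen a b : (a <= b)%N -> \sum_x cmod (S b x - S a x) ^+ 2 <=
    \sum_(a <= i < b) X0 * \sum_(y | Y y && (ge y == i)) w y.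
  move=> ab.
  have -> : \sum_(a <= i < b) X0 * \sum_(y | Y y && (ge y == i)) w y =
     X0 * \sum_(y | Y y && (a <= ge y < b)%N) w y.
    rewrite -mulr_sumr; congr (_ * _).
    rewrite (exchange_big_dep Y) /=; last by move=> i y _ /andP[].
    rewrite [RHS]big_mkcondr /=; apply: eq_bigr => y Yy.
    rewrite (eq_bigl (fun i => i == ge y)); last by move=> i; rewrite Yy eq_sym.
    by rewrite big_nat1_eq.
  under eq_bigr => x _.
    have -> : S b x - S a x =
        \sum_(y | Y y && (a <= ge y < b)%N) K (jj y) x y * f y.
      apply/eqP; rewrite subr_eq /S; apply/eqP.
      rewrite (bigID (fun y => (ge y < a)%N)) /= addrC; congr (_ + _).
        by apply: eq_bigl => y; rewrite -leqNgt -andbA [(_ < b)%N && _]andbC.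
      apply: eq_bigl => y; rewrite -andbA; congr (_ && _).
      by apply/andP/idP => [[]//|h]; split => //; lia.
    over.
  by apply: orth => y /andP[].
(* The first [2 ^ (2 t)] generations cost a factor [(2 t + 1) ^ 2]; the later ones go to [Rm], with
   absolute values. *)
have [D [D0 Dmax Dsum]] := rademacher_menshov Smen (2 * t) 0.
have S0 x : S 0%N x = 0 by apply: big1 => y /andP[].
pose Rm x := \sum_(y | Y y && (2 ^ (2 * t) <= ge y)%N) cmod (K (jj y) x y) * w y.
have Rm0 x : 0 <= Rm x.
  by rewrite sumr_ge0 // => y _; rewrite mulr_ge0 ?cmod_ge0.
have L0 x : 0 <= layer_max x.
  by rewrite sumr_ge0 // => y _; rewrite mulr_ge0 ?cmod_ge0.
(* The minimum retains the bound by [layer_max], to be paired with [g ^ r]. *)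
exists (fun x => Num.min (D x + Rm x) (layer_max x)); split.
- by move=> x; rewrite le_min L0 addr_ge0.
- move=> x k; rewrite le_min; apply/andP; split; last first.
    apply: le_trans (cmod_sum _ _ _) _; rewrite big_mkcond [leRHS]big_mkcond /=.
    apply: ler_sum => y _; case: (Y y) => //=.
    by rewrite cmodM; case: ifP => // _; rewrite mulr_ge0 ?cmod_ge0.
  (* [gen_scale] applies wherever the kernel does not vanish, and the other terms are zero on both
     sides. *)
  pose m := gen lab q s t Y (k + 2) x.
  have -> : \sum_(y | Y y && (k <= jj y)%N) K (jj y) x y * f y = S m x.
    rewrite /S big_mkcondr [RHS]big_mkcondr /=; apply: eq_bigr => y Yy.
    have [-> |Kn0] := eqVneq (K (jj y) x y) 0; first by rewrite mul0r !if_same.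
    have e' : lab (lv y) y = lab (lv y) x.
      by have := K_supp (jj_q Yy) Kn0; rewrite (scaleK Y_lev Yy).
    by rewrite (gen_scale (lab := lab) (q := q) lab_nest Y_lev k Yy e').
  have [h|h] := leqP m (2 ^ (2 * t)).
    have := Dmax _ x h; rewrite add0n S0 subr0 => h'.
    by rewrite (le_trans h') // lerDl.
  have -> : S m x = S (2 ^ (2 * t))%N x +
     \sum_(y | Y y && (2 ^ (2 * t) <= ge y < m)%N) K (jj y) x y * f y.
    rewrite /S (bigID (fun y => (ge y < 2 ^ (2 * t))%N)) /=; congr (_ + _).
      apply: eq_bigl => y; rewrite -andbA; congr (_ && _).
      by apply/andP/idP => [[]//|h']; split => //; exact: ltn_trans h.
    by apply: eq_bigl => y; rewrite -leqNgt -andbA [(_ < m)%N && _]andbC.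
  apply: le_trans (cmodD _ _) _; apply: lerD.
    by have := Dmax _ x (leqnn _); rewrite add0n S0 subr0.
  apply: le_trans (cmod_sum _ _ _) _; rewrite big_mkcond [leRHS]big_mkcond /=.
  apply: ler_sum => y _; case: (Y y) => //=; rewrite cmodM.
  case: (2 ^ (2 * t) <= ge y)%N => //=.
  by case: ifP => // _; rewrite mulr_ge0 ?cmod_ge0.
- by move=> x; rewrite ge_min lexx orbT.
- apply: (@le_trans _ _ (\sum_(x | I x) (D x + Rm x))).
    by apply: ler_sum => x _; rewrite ge_min lexx.
  rewrite big_split /=; apply: lerD.
    (* AM-GM: [D <= (D ^ 2 / tau + tau) / 2], in place of Cauchy-Schwarz. *)
    apply: (@le_trans _ _ (\sum_(x | I x) (D x ^+ 2 / tau + tau * 1) / 2)).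
      apply: ler_sum => x _; rewrite -subr_ge0 mulr1.
      have -> : (D x ^+ 2 / tau + tau) / 2 - D x = (D x - tau) ^+ 2 / tau / 2.
        by field; rewrite gt_eqF.
      by rewrite !divr_ge0 ?sqr_ge0 // ltW.
    rewrite -mulr_suml big_split /= -mulr_suml -mulr_sumr I_size.
    rewrite ler_pM2r ?invr_gt0 // lerD2r ler_pM2r ?invr_gt0 //.
    apply: (@le_trans _ _ (\sum_x D x ^+ 2)).
      rewrite [leLHS]big_mkcond /=; apply: ler_sum => x _.
      by case: ifP => // _; exact: sqr_ge0.
    apply: le_trans Dsum _; rewrite ler_wpM2l ?exprn_ge0 //.
    rewrite -mulr_sumr ler_wpM2l //.
    apply: le_trans sum_Y_le.
    rewrite (exchange_big_dep Y) /=; last by move=> i y _ /andP[].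
    apply: ler_sum => y Yy.
    rewrite (eq_bigl (fun i => i == ge y)); last by move=> i; rewrite Yy eq_sym.
    by rewrite big_nat1_eq; case: ifP.
  apply: (@le_trans _ _ (\sum_x 1 * Rm x)).
    rewrite [leLHS]big_mkcond /=; apply: ler_sum => x _.
    by rewrite mul1r; case: ifP.
  apply: le_trans (absolute_bound (lab := lab) (q := q) (c := 1) K_size K_supp _ _ _ _) _ => //.
  + by move=> y /andP[Yy _]; exact: jj_q.
  + by move=> y /andP[Yy _]; rewrite lab_card ?mul1r ?jj_q.
  (* With [M = 2 ^ (2 t)] the mass of the high generations is at most [8 lam 2 ^ q / 2 ^ t]; the
     absolute bound multiplies it by 16. *)
  + have := high_generation_mass (lab := lab) lab_nest lab_card I_size s_atom s_le YI
       Y_atom Y_lev (2 ^ (2 * t)) w0 lam_ge0 w_atom.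
    rewrite natrX mulnC exprM expr2 => h.
    have u0 := pow2_gt0 R t; move: h; set u := 2 ^+ t in u0 *; set T := (\sum_(y | _) _) => h.
    rewrite ler_pdivlMr // mulr1.
    have h2 : u * (u * T) <= u * (8 * lam * 2 ^+ q) by move: h; rewrite /u; lra.
    move: h2; rewrite ler_pM2l // => h2; lra.
Qed.

End Maximal.

(** * Numerical series *)

Section Numbers.
Variable R : realType.
Implicit Types (h r u tau G : R).

Lemma sum_odd_geom_le h n : 0 <= h < 1 ->
  \sum_(0 <= t < n) (2 * t).+1%:R * h ^+ t <= 2 / (1 - h) ^+ 2.
Proof.
move=> /andP[h0 h1]; have p : 0 < (1 - h) ^+ 2 by rewrite exprn_gt0 // subr_gt0.
rewrite ler_pdivlMr //.
have -> : (\sum_(0 <= t < n) (2 * t).+1%:R * h ^+ t) * (1 - h) ^+ 2 =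
    1 + h - h ^+ n * (2 * n%:R * (1 - h) + (1 + h)).
  elim: n => [|n IH]; first by rewrite big_geq // expr0; ring.
  have e : (2 * n).+1%:R = 2 * n%:R + 1 :> R by rewrite -natr1 natrM.
  by rewrite big_nat_recr //= e mulrDl IH (exprS h n) -[n.+1%:R]natr1; ring.
have : 0 <= h ^+ n * (2 * n%:R * (1 - h) + (1 + h)).
  rewrite mulr_ge0 ?exprn_ge0 //.
  have h2 : 0 <= 2 * n%:R * (1 - h) by rewrite mulr_ge0 ?mulr_ge0 //; lra.
  by lra.
by lra.
Qed.

Lemma sum_geom_le h n : 0 <= h < 1 ->
  \sum_(0 <= t < n) h ^+ t <= (1 - h)^-1.
Proof.
move=> /andP[h0 h1]; have p : 0 < 1 - h by rewrite subr_gt0.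
rewrite -[leRHS]mul1r ler_pdivlMr //.
have -> : (\sum_(0 <= t < n) h ^+ t) * (1 - h) = 1 - h ^+ n.
  elim: n => [|n IH]; first by rewrite big_geq // expr0; ring.
  by rewrite big_nat_recr //= mulrDl IH (exprS h n); ring.
by have := exprn_ge0 n h0; lra.
Qed.

(** The origin of the factor [1 / (r - 1)]: by [e ^ x >= 1 + x], the ratio [h ^ (r - 1)] stays at a
    distance from 1 at least proportional to [r - 1]. *)
Lemma sum_powR_le h r n : 0 < h < 1 -> 1 < r < 2 ->
  \sum_(0 <= t < n) (h `^ (r - 1)) ^+ t <= (1 + (- ln h)^-1) / (r - 1).
Proof.
move=> /andP[h0 h1] /andP[r1 r2].
set l := - ln h; have l0 : 0 < l by rewrite oppr_gt0 ln_lt0 // h0 h1.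
set u := r - 1; have u0 : 0 < u by rewrite subr_gt0.
have u1 : u < 1 by rewrite /u; lra.
have e1 : 1 + u * l <= expR (u * l) by exact: expR_ge1Dx.
have hE : h `^ u = (expR (u * l))^-1.
  by rewrite /powR gt_eqF // -expRN /l mulrN opprK.
have ul0 : 0 < u * l by rewrite mulr_gt0.
have x1 : h `^ u <= (1 + u * l)^-1.
  by rewrite hE lef_pV2 // posrE; lra.
have d : u / (1 + l^-1) <= 1 - h `^ u.
  apply: (@le_trans _ _ (1 - (1 + u * l)^-1)); last by lra.
  have -> : 1 - (1 + u * l)^-1 = u / (l^-1 + u).
    by field; rewrite !gt_eqF // ?addr_gt0 // ?invr_gt0 // ?mulr_gt0.
  have l10 : 0 < l^-1 by rewrite invr_gt0.
  by rewrite ler_pM2l // lef_pV2 ?posrE; lra.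
have D0 : 0 < u / (1 + l^-1) by rewrite divr_gt0 // addr_gt0 // invr_gt0.
apply: le_trans (sum_geom_le _ _) _; first by rewrite powR_ge0 /=; lra.
have -> : (1 + l^-1) / u = (u / (1 + l^-1))^-1 by rewrite invf_div.
by rewrite lef_pV2 // posrE //; lra.
Qed.

(** Above the height [tau], write [u = u ^ r * u ^ (1 - r)] and use that [1 - r] is negative. *)
Lemma le_split_powR u tau r : 0 <= u -> 0 < tau -> 1 < r ->
  u <= tau + u `^ r * tau `^ (1 - r).
Proof.
move=> u0 t0 r1; have [h|h] := leP u tau.
  by rewrite (le_trans h) // lerDl mulr_ge0 ?powR_ge0.
have up : 0 < u by exact: lt_trans h.
apply: (@le_trans _ _ (u `^ r * tau `^ (1 - r))); last by rewrite lerDr ltW.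
have {1}-> : u = u `^ r * u `^ (1 - r).
  rewrite -powRD; last by rewrite (gt_eqF up) implybT.
  by rewrite addrCA subrr addr0 powRr1.
rewrite ler_pM2l ?powR_gt0 // -[1 - r]opprB !powRN lef_pV2 ?posrE ?powR_gt0 //.
by apply: ge0_ler_powR; rewrite ?nnegrE; lra.
Qed.

End Numbers.

(** * The part of the operator above the stopped cells *)

(** Change of variable [t = j + 3 - s]: [s < j + 3] becomes [1 <= t], and [j < q - 2] becomes
    [s + t <= q]. The condition [3 <= s + t] keeps [s + t - 3] from being truncated. *)
Lemma sum_scale_reindex (V : nmodType) (F : nat -> V) (q k s : nat) :
  \sum_(0 <= j < q - 2) (if (k <= j)%N && (s < j + 3)%N then F j else 0) =
  \sum_(1 <= t < q.+1)
    (if (3 <= s + t <= q)%N && (k <= s + t - 3)%N then F (s + t - 3)%N else 0).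
Proof.
transitivity (\sum_(0 <= j < q - 2) \sum_(1 <= t < q.+1 | (k <= j)%N && (s + t == j + 3)%N) F j).
  apply: eq_big_nat => j jq; case: (leqP k j) => kj /=; last by rewrite big_pred0.
  case: ltnP => hs.
    rewrite (eq_bigl (fun t => t == j + 3 - s)%N); last by move=> t; apply/eqP/eqP; lia.
    by rewrite big_nat1_eq ifT //; lia.
  by rewrite big_nat_cond big_pred0 // => t; apply/negP => /andP[h /eqP]; lia.
rewrite (exchange_big_dep xpredT) //=; apply: eq_big_nat => t tq.
have [h3|h3] := leqP 3 (s + t); last first.
  by rewrite big_pred0 // => j; apply/negP => /andP[h /eqP]; lia.
rewrite (eq_bigl (fun j => (j == s + t - 3) && (k <= s + t - 3))%N); last first.
  by move=> j; apply/andP/andP => -[/idP h1 /eqP h2]; split; try apply/eqP; lia.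
rewrite big_mkcondr /= big_nat1_eq /=.
have -> : (s + t - 3 < q - 2)%N = (s + t <= q)%N by lia.
by case: (s + t <= q)%N.
Qed.

Lemma sum_ltn_le (n c : nat) : (\sum_(0 <= t < n) (t < c) <= minn n c)%N.
Proof.
elim: n => [|n IH]; first by rewrite big_geq.
by rewrite big_nat_recr //=; case: ltnP IH => /=; lia.
Qed.

(** The first term comes from [g] below the splitting height, with the Rademacher-Menshov loss
    [2 t + 1]; the second from [g] above it; the third is the absolute bound for the finitely many
    small [t]. *)
Definition layer_const (R : realType) (A h : R) (C0 : nat) (r : R) (t : nat) : R :=
  (2000 + 300 * A) * ((2 * t).+1%:R * h ^+ t) + 64 * (h `^ (r - 1)) ^+ t
  + 80 * (t < C0 + 4)%N%:R.

(** Sum of [layer_const] over [t] and over the [m0] residue classes, with [1 / (r - 1)] factored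
    out. *)
Definition local_const (R : realType) (A h : R) (m0 C0 : nat) : R :=
  m0%:R * ((2000 + 300 * A) * (2 / (1 - h) ^+ 2) + 64 * (1 + (- ln h)^-1)
           + 80 * (C0 + 4)%:R).

Section Local.
Variables (R : realType) (X : finType) (lab : nat -> X -> nat) (q : nat).
Hypothesis lab_nest : forall p p' x y,
  (p <= p')%N -> lab p x = lab p y -> lab p' x = lab p' y.
Hypothesis lab_card : forall p x, (p <= q)%N ->
  \sum_(y | lab p y == lab p x) 1 = 2 ^+ p :> R.
Variable K : nat -> X -> X -> R[i].
Hypothesis K_size : forall j x y, (j + 3 <= q)%N -> cmod (K j x y) <= 2 / 2 ^+ j.
Hypothesis K_supp : forall j x y, (j + 3 <= q)%N -> K j x y != 0 ->
  lab (j + 3)%N x = lab (j + 3)%N y.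
Variables (A h : R) (m0 C0 : nat).
Hypothesis A_ge0 : 0 <= A.
Hypothesis h_gt0 : 0 < h.
Hypothesis h_lt1 : h < 1.
Hypothesis h4 : 2^-1 <= h ^+ 4.
Hypothesis m0_gt0 : (0 < m0)%N.
Hypothesis K_gram : forall j k y y', (j + 3 <= q)%N -> (C0 < k)%N ->
  (j = k /\ y != y') \/ (k + m0 <= j)%N ->
  cmod (gram K j y k y') <= A * (h ^+ 4) ^+ k / 2 ^+ j.
Variables (I : pred X) (s : X -> nat).
Hypothesis I_size : \sum_(x | I x) 1 = 2 ^+ q :> R.
Hypothesis I_lab : forall x y, I x -> lab q x = lab q y -> I y.
Hypothesis s_atom : forall x y, I x -> lab (s x) y = lab (s x) x -> s y = s x.
Hypothesis s_le : forall x, I x -> (s x <= q)%N.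
Hypothesis s_up : forall p x y, I x -> I y -> (p <= q)%N ->
  lab p x = lab p y -> (s x < p)%N -> (s y < p)%N.
Variables (f : X -> R[i]) (g : X -> R) (lam G r : R).
Let w y := cmod (f y).
Hypothesis lam_ge0 : 0 <= lam.
Hypothesis g_ge0 : forall x, 0 <= g x.
Hypothesis G_ge0 : 0 <= G.
Hypothesis r12 : 1 < r < 2.
Hypothesis w_total : \sum_(x | I x) w x <= lam * 2 ^+ q.
Hypothesis w_atom : forall x, I x ->
  \sum_(y | lab (s x) y == lab (s x) x) w y <= 8 * lam * 2 ^+ s x.
Hypothesis w_good : forall p x, I x -> (s x < p <= q)%N ->
  \sum_(y | lab p y == lab p x) w y <= 4 * lam * 2 ^+ p.
Hypothesis g_total : \sum_(x | I x) g x `^ r <= G `^ r * 2 ^+ q.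
Hypothesis g_good : forall p x, I x -> (s x < p <= q)%N ->
  \sum_(y | lab p y == lab p x) g y `^ r <= 4 * G `^ r * 2 ^+ p.

Let r1 : 1 < r. Proof. by case/andP: r12. Qed.

Let r0 : r != 0. Proof. by rewrite gt_eqF // (lt_trans _ r1). Qed.

Lemma g_eq0 x : G = 0 -> I x -> g x = 0.
Proof.
move=> G0 Ix; move: g_total; rewrite G0 powR0 // mul0r => h0.
have : g x `^ r <= 0.
  apply: le_trans h0; rewrite (bigD1 x) //= lerDl.
  by apply: sumr_ge0 => y _; exact: powR_ge0.
move=> h1.
have /eqP : g x `^ r == 0 by rewrite eq_le h1 powR_ge0.
by move=> /powR_eq0_eq0.
Qed.

(* Splitting [g] at the height [H G] interpolates between the bound of [V]
   against bounded functions and its bound against [g ^ r]. *)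
Lemma split_height (V : X -> R) (H a b : R) :
  (forall x, 0 <= V x) -> 0 < H ->
  \sum_(x | I x) V x <= a ->
  \sum_(x | I x) g x `^ r * V x <= b * G `^ r ->
  \sum_(x | I x) g x * V x <= (H * a + H `^ (1 - r) * b) * G.
Proof.
move=> V0 H0 ha hb.
have [G0|Gn0] := eqVneq G 0.
  by rewrite G0 mulr0 big1 // => x Ix; rewrite (g_eq0 G0 Ix) mul0r.
have Gp : 0 < G by rewrite lt_neqAle eq_sym Gn0.
have tau0 : 0 < H * G by rewrite mulr_gt0.
apply: (@le_trans _ _ (\sum_(x | I x)
   (H * G * V x + (H * G) `^ (1 - r) * (g x `^ r * V x)))).
  apply: ler_sum => x _; rewrite [_ `^ (1 - r) * _]mulrCA mulrA -mulrDl ler_wpM2r //.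
  exact: le_split_powR.
rewrite big_split /= -!mulr_sumr.
have -> : (H * a + H `^ (1 - r) * b) * G =
   H * G * a + (H * G) `^ (1 - r) * (b * G `^ r).
  rewrite powRM ?ltW //.
  have GE : G `^ (1 - r) * G `^ r = G.
    rewrite -powRD; last by rewrite Gn0 implybT.
    by rewrite subrK powRr1.
  transitivity (H * G * a + H `^ (1 - r) * b * (G `^ (1 - r) * G `^ r)); last by ring.
  by rewrite GE; ring.
by rewrite lerD // ler_wpM2l ?powR_ge0 // ltW.
Qed.

(* Restricting scales to a residue class modulo [m0] removes the pairs
   [0 < |j - k| < m0], about which the hypotheses say nothing. *)
Definition layer t rho : pred X := fun y =>
  [&& I y, (3 <= s y + t <= q)%N & ((s y + t - 3) %% m0 == rho)%N].

(** For [t < C0 + 4] absolute values suffice. Otherwise every scale of the layer exceeds [C0] and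
    the Gram entries gain [h ^ (4 t)]; the choice [tau = lam (2 t + 1) h ^ (2 t)] balances AM-GM and
    leaves [h ^ (2 t)], of which the splitting height [h ^ (- t)] spends one half. *)
Lemma layer_bound t rho : (0 < t)%N -> exists V : X -> R,
  [/\ forall x, 0 <= V x,
      forall x k, cmod (\sum_(y | layer t rho y && (k <= scale s t y)%N)
                     K (scale s t y) x y * f y) <= V x &
      \sum_(x | I x) g x * V x <= layer_const A h C0 r t * (lam * 2 ^+ q) * G].
Proof.
move=> t0; set Y := layer t rho.
have YI y : Y y -> I y by case/and3P.
have Y_lev y : Y y -> (3 <= s y + t <= q)%N by case/and3P.
have Y_atom y z : Y y -> lab (s y) z = lab (s y) y -> Y z.
  move=> /and3P[Iy h1 h2] e; rewrite /Y /layer (s_atom Iy e) h1 h2 !andbT.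
  by apply: (I_lab Iy); apply: lab_nest (esym e); exact: s_le.
have q0 : 0 < 2 ^+ q :> R by exact: pow2_gt0.
have habs1 : \sum_(x | I x) 1 * layer_max K s t Y f x <= 16 * 1 * (lam * 2 ^+ q).
  apply: (layer_abs (lab := lab)) => //.
  by move=> p x Ix /andP[_ pq]; rewrite lab_card // mul1r.
have habsr : \sum_(x | I x) g x `^ r * layer_max K s t Y f x <=
    16 * (4 * G `^ r) * (lam * 2 ^+ q).
  apply: (layer_abs (lab := lab)) => //.
  - by rewrite mulr_ge0 // powR_ge0.
  - by move=> x; exact: powR_ge0.
have L0 x : 0 <= layer_max K s t Y f x.
  by rewrite sumr_ge0 // => y _; rewrite mulr_ge0 ?cmod_ge0.
have hx0 : 0 <= (2 * t).+1%:R * h ^+ t by rewrite mulr_ge0 // exprn_ge0 // ltW.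
have hy0 : 0 <= (h `^ (r - 1)) ^+ t by rewrite exprn_ge0 // powR_ge0.
have lq0 : 0 <= lam * 2 ^+ q by rewrite mulr_ge0 // ltW.
case: (boolP ((t < C0 + 4)%N || (lam == 0))) => [triv|].
  exists (layer_max K s t Y f); split=> //.
    move=> x k; apply: le_trans (cmod_sum _ _ _) _.
    rewrite big_mkcond [leRHS]big_mkcond /=.
    apply: ler_sum => y _; case: (Y y) => //=.
    by rewrite cmodM; case: ifP => // _; rewrite mulr_ge0 ?cmod_ge0.
  apply: le_trans (split_height L0 ltr01 (a := 16 * (lam * 2 ^+ q))
     (b := 64 * (lam * 2 ^+ q)) _ _) _.
  - by move: habs1; under eq_bigr do rewrite mul1r; rewrite mulr1.
  - by apply: le_trans habsr _; rewrite le_eqVlt; apply/orP; left; apply/eqP; ring.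
  rewrite ler_wpM2r // powR1; have [lam0|lamn0] := eqVneq lam 0.
    by rewrite lam0 !mul0r !mulr0 addr0.
  move: triv; rewrite (negbTE lamn0) orbF => tC.
  rewrite /layer_const tC /=.
  have := mulr_ge0 A_ge0 hx0; set x1 := _ * h ^+ t in hx0 *; set y1 := _ ^+ t in hy0 *.
  move=> Ax0.
  have -> : 1 * (16 * (lam * 2 ^+ q)) + 1 * (64 * (lam * 2 ^+ q)) = 80 * (lam * 2 ^+ q).
    by ring.
  by rewrite ler_wpM2r //; lra.
rewrite negb_or -leqNgt => /andP[tC lamn0].
have lamp : 0 < lam by rewrite lt_neqAle eq_sym lamn0.
have h2t : 0 < h ^+ (2 * t) by rewrite exprn_gt0.
have e0 : 0 <= 8 * A * (h ^+ 4) ^+ t by rewrite mulr_ge0 ?mulr_ge0 ?exprn_ge0 // ltW.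
have n0 : 0 < (2 * t).+1%:R :> R by rewrite ltr0n.
have tau0 : 0 < lam * ((2 * t).+1%:R * h ^+ (2 * t)) by rewrite !mulr_gt0.
have hgram y y' : Y y -> Y y' -> (scale s t y' <= scale s t y)%N -> y != y' ->
    cmod (gram K (scale s t y) y (scale s t y') y') <=
      8 * A * (h ^+ 4) ^+ t / 2 ^+ scale s t y.
  move=> Yy Yy' hs yy'.
  have hC : (C0 < scale s t y')%N by move: (Y_lev _ Yy') tC; clear; rewrite /scale; lia.
  have hq : (scale s t y + 3 <= q)%N by move: (Y_lev _ Yy); clear; rewrite /scale; lia.
  apply: le_trans (K_gram hq hC _) _.
    (* Distinct scales in one residue class differ by at least [m0]. *)
    have [->|sn] := eqVneq (scale s t y) (scale s t y'); [by left|right].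
    have m1 : (scale s t y %% m0 = rho)%N by case/and3P: Yy => _ _ /eqP.
    have m2 : (scale s t y' %% m0 = rho)%N by case/and3P: Yy' => _ _ /eqP.
    have hlt : (scale s t y' < scale s t y)%N by rewrite ltn_neqAle eq_sym sn.
    have : (m0 %| scale s t y - scale s t y')%N by rewrite -eqn_mod_dvd // m1 m2.
    by move=> /dvdn_leq; rewrite subn_gt0 hlt => /(_ isT); move: hlt; clear; lia.
  rewrite ler_wpM2r ?invr_ge0 ?exprn_ge0 //.
  rewrite [8 * A]mulrC -mulrA ler_wpM2l //.
  have b0 : 0 <= h ^+ 4 by rewrite exprn_ge0 // ltW.
  have b1 : h ^+ 4 <= 1 by rewrite exprn_ile1 // ltW.
  (* The scale is at least [t - 3]; restoring the exponent [t] costs at most [8], as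
     [2^-1 <= h ^ 4]. *)
  apply: (@le_trans _ _ ((h ^+ 4) ^+ (t - 3))).
    by rewrite ler_wiXn2l // /scale leq_sub2r // leq_addl.
  have -> : (h ^+ 4) ^+ t = (h ^+ 4) ^+ (t - 3) * (h ^+ 4) ^+ 3.
    by rewrite -exprD subnK //; move: tC; clear; lia.
  have b3 : 8^-1 <= (h ^+ 4) ^+ 3.
    have -> : 8^-1 = (2^-1) ^+ 3 :> R by field.
    by rewrite lerXn2r // nnegrE // invr_ge0.
  rewrite mulrCA -[leLHS]mulr1 ler_wpM2l ?(exprn_ge0 _ b0) //.
  by move: b3; set z := _ ^+ 3; lra.
have [V [V0 Vmax Vabs Vsum]] := layer_maximal (lab := lab) (I := I) lab_nest lab_card K_size K_supp
  I_size s_atom s_le YI Y_atom Y_lev lam_ge0 t0 w_total w_atom w_good e0 tau0 hgram.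
exists V; split => //.
have hm0 : 0 < h ^- t by rewrite invr_gt0 exprn_gt0.
set y2 := h ^+ (2 * t) in h2t tau0 Vsum.
have hV : \sum_(x | I x) V x <=
    (2000 + 300 * A) * ((2 * t).+1%:R * y2) * (lam * 2 ^+ q).
  apply: le_trans Vsum _.
  have y2E : (h ^+ 4) ^+ t = y2 ^+ 2.
    by rewrite /y2 -!exprM mulnAC.
  (* By [2^-1 <= h ^ 4], the terms in [2 ^ (- t)] decay at least as fast as [h ^ (4 t)]. *)
  have ti : (2 ^+ t)^-1 <= y2 ^+ 2.
    rewrite -exprVn -y2E lerXn2r ?nnegrE ?invr_ge0 ?exprn_ge0 //; exact: ltW.
  have y21 : y2 <= 1 by rewrite /y2 exprn_ile1 // ltW.
  set N := (2 * t).+1%:R in n0 tau0 *.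
  have N1 : 1 <= N by rewrite ler1n.
  rewrite y2E; set i2 := (2 ^+ t)^-1 in ti *; set Q := lam * 2 ^+ q in lq0 *.
  have P1 : N ^+ 2 * ((2048 * lam * i2 + 64 * (8 * A * y2 ^+ 2) * lam) * Q) /
      (lam * (N * y2)) <= (2048 + 512 * A) * (N * y2) * Q.
    rewrite ler_pdivrMr //.
    have -> : (2048 + 512 * A) * (N * y2) * Q * (lam * (N * y2)) =
      N ^+ 2 * ((2048 * lam * y2 ^+ 2 + 64 * (8 * A * y2 ^+ 2) * lam) * Q) by ring.
    rewrite ler_wpM2l ?sqr_ge0 // ler_wpM2r // lerD2r.
    have := ler_wpM2l lam_ge0 ti; lra.
  have P2 : lam * (N * y2) * 2 ^+ q = N * y2 * Q by rewrite /Q; ring.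
  have P3 : Q * i2 <= N * y2 * Q.
    rewrite mulrC ler_wpM2r // (le_trans ti) // expr2 ler_wpM2r ?(ltW h2t) //.
    exact: le_trans N1.
  have P0 : 0 <= N * y2 * Q by rewrite mulr_ge0 // mulr_ge0 // ltW.
  have P4 := mulr_ge0 A_ge0 P0.
  move: P1 P3 P0 P4.
  have -> : (2048 + 512 * A) * (N * y2) * Q = 2048 * (N * y2 * Q) + 512 * (A * (N * y2 * Q)).
    by ring.
  have -> : (2000 + 300 * A) * (N * y2) * Q = 2000 * (N * y2 * Q) + 300 * (A * (N * y2 * Q)).
    by ring.
  rewrite P2 -[128 * Q * i2]mulrA; move: (N * y2 * Q) (Q * i2) (_ / (lam * _)) => u1 u2 u3.
  move: (A * u1) => u4; lra.
(* The part of [g] below the height yields [h ^ (2 t) * h ^ (- t) = h ^ t], the part above it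
   [h ^ (t (r - 1))]. *)
apply: le_trans (split_height (H := h ^- t) V0 hm0 hV (b := 64 * (lam * 2 ^+ q)) _) _.
  apply: (@le_trans _ _ (16 * (4 * G `^ r) * (lam * 2 ^+ q))); last first.
    by rewrite le_eqVlt; apply/orP; left; apply/eqP; ring.
  apply: le_trans habsr; apply: ler_sum => x _.
  by rewrite ler_wpM2l ?powR_ge0.
rewrite ler_wpM2r //.
have E1 : h ^- t * ((2000 + 300 * A) * ((2 * t).+1%:R * y2) * (lam * 2 ^+ q)) =
   (2000 + 300 * A) * ((2 * t).+1%:R * h ^+ t) * (lam * 2 ^+ q).
  have -> : y2 = h ^+ t * h ^+ t by rewrite /y2 -exprD addnn mul2n.
  by field; rewrite expf_neq0 // gt_eqF.
have E2 : (h ^- t) `^ (1 - r) = (h `^ (r - 1)) ^+ t.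
  rewrite -(powR_mulrn t (powR_ge0 _ _)) -(powR_invn t (ltW h_gt0)) -!powRrM.
  by congr (_ `^ _); ring.
rewrite E1 E2 /layer_const ltnNge tC /= mulr0 addr0 le_eqVlt; apply/orP; left; apply/eqP.
by ring.
Qed.

(** The kernel of scale [j] stays in one cell of level [j + 3], and [s_up] says that [s x < j + 3]
    depends only on this cell. The condition thus passes from the output point [x] to the input
    point [y], whose scales are then sorted by [t] and by residue. *)
Lemma layer_decomposition x k : I x ->
  \sum_(0 <= j < q - 2 | (k <= j)%N && (s x < j + 3)%N) \sum_y K j x y * f y =
  \sum_(1 <= t < q.+1) \sum_(0 <= rho < m0)
    \sum_(y | layer t rho y && (k <= scale s t y)%N) K (scale s t y) x y * f y.
Proof.
move=> Ix; pose c y j := K j x y * f y.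
transitivity (\sum_(y | I y) \sum_(0 <= j < q - 2)
    (if (k <= j)%N && (s y < j + 3)%N then c y j else 0)).
  rewrite [RHS]exchange_big /= [LHS]big_mkcond /=; apply: eq_big_nat => j jq.
  have jq3 : (j + 3 <= q)%N by move: jq; clear; lia.
  rewrite [RHS]big_mkcond /=.
  have [kj|kj] := boolP (k <= j)%N; last by rewrite /= big1 // => y _; rewrite if_same.
  case: ifPn => /= hs.
    apply: eq_bigr => y _; rewrite /c.
    have [-> |Kn0] := eqVneq (K j x y) 0; first by rewrite mul0r !if_same.
    have e := K_supp jq3 Kn0; have Iy : I y by apply: (I_lab Ix); exact: lab_nest e.
    by rewrite Iy (s_up Ix Iy jq3 e hs).
  rewrite big1 // => y _; case: ifPn => // Iy; case: ifPn => // hy.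
  rewrite /c; have [-> |Kn0] := eqVneq (K j x y) 0; first by rewrite mul0r.
  have e := K_supp jq3 Kn0.
  by move: hs; rewrite (s_up Iy Ix jq3 (esym e) hy).
under eq_bigr => y _ do rewrite sum_scale_reindex.
rewrite exchange_big /=; apply: eq_big_nat => t _.
transitivity (\sum_(y | I y) \sum_(0 <= rho < m0 | rho == ((s y + t - 3) %% m0)%N)
    (if (3 <= s y + t <= q)%N && (k <= s y + t - 3)%N then c y (s y + t - 3)%N else 0)).
  by apply: eq_bigr => y _; rewrite big_nat1_eq ltn_mod m0_gt0.
rewrite (exchange_big_dep xpredT) //=; apply: eq_bigr => rho _.
rewrite big_mkcond [RHS]big_mkcond /=; apply: eq_bigr => y _.
rewrite /layer [rho == _]eq_sym /scale.
by case: (I y) => //=; case: (_ == rho) => //=; case: (2 < s y + t <= q)%N.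
Qed.

(** Add up the majorants of the layers. The series without a factor [1 / (r - 1)] receive one for
    free, since [r - 1 <= 1]. *)
Lemma local_estimate : exists V : X -> R,
  [/\ forall x, 0 <= V x,
      forall x k, I x -> cmod (\sum_(0 <= j < q - 2 | (k <= j)%N && (s x < j + 3)%N)
         \sum_y K j x y * f y) <= V x &
      \sum_(x | I x) g x * V x <=
        local_const A h m0 C0 / (r - 1) * (lam * 2 ^+ q) * G].
Proof.
have /boolp.choice[V hV] : forall p : nat * nat, exists V : X -> R, (0 < p.1)%N ->
  [/\ forall x, 0 <= V x,
      forall x k, cmod (\sum_(y | layer p.1 p.2 y && (k <= scale s p.1 y)%N)
                     K (scale s p.1 y) x y * f y) <= V x &
      \sum_(x | I x) g x * V x <= layer_const A h C0 r p.1 * (lam * 2 ^+ q) * G].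
  move=> [t rho]; case: t => [|t]; first by exists (fun=> 0).
  by have [V hV] := @layer_bound t.+1 rho isT; exists V.
exists (fun x => \sum_(1 <= t < q.+1) \sum_(0 <= rho < m0) V (t, rho) x); split.
- move=> x; rewrite big_nat_cond sumr_ge0 // => t /andP[/andP[t0 _] _].
  by rewrite sumr_ge0 // => rho _; have [] := hV (t, rho) t0.
- move=> x k Ix; rewrite layer_decomposition //.
  apply: le_trans (cmod_sum _ _ _) _; rewrite !big_nat; apply: ler_sum => t /andP[t0 _].
  apply: le_trans (cmod_sum _ _ _) _; apply: ler_sum => rho _.
  by have [_ + _] := hV (t, rho) t0; exact.
have Q0 : 0 <= lam * 2 ^+ q * G.
  by rewrite !mulr_ge0 // ltW // pow2_gt0.
apply: (@le_trans _ _ (\sum_(1 <= t < q.+1)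
    m0%:R * layer_const A h C0 r t * (lam * 2 ^+ q * G))).
  under eq_bigr do rewrite mulr_sumr.
  rewrite exchange_big /= !big_nat; apply: ler_sum => t /andP[t0 _].
  under eq_bigr do rewrite mulr_sumr.
  rewrite exchange_big /=.
  have -> : m0%:R * layer_const A h C0 r t * (lam * 2 ^+ q * G) =
     \sum_(0 <= rho < m0) layer_const A h C0 r t * (lam * 2 ^+ q) * G.
    by rewrite sumr_const_nat subn0 -mulr_natl; ring.
  by apply: ler_sum => rho _; have [] := hV (t, rho) t0.
rewrite -mulr_suml -mulr_sumr -mulrA [leRHS](_ : _ =
  local_const A h m0 C0 / (r - 1) * (lam * 2 ^+ q * G)); last by ring.
rewrite mulrA ler_wpM2r // /local_const -mulrA ler_wpM2l //.
have hc t : 0 <= layer_const A h C0 r t.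
  rewrite /layer_const; have h1 : 0 <= (2 * t).+1%:R * h ^+ t.
    by rewrite mulr_ge0 // exprn_ge0 // ltW.
  have h2 := mulr_ge0 A_ge0 h1.
  have h3 : 0 <= (h `^ (r - 1)) ^+ t by rewrite exprn_ge0 // powR_ge0.
  have h5 : 0 <= (t < C0 + 4)%N%:R :> R by rewrite ler0n.
  move: h1 h2 h3 h5; set x1 := _ * h ^+ t; set x3 := _ ^+ t; set x5 := _%:R => h1 h2 h3 h5.
  have -> : (2000 + 300 * A) * x1 = 2000 * x1 + 300 * (A * x1) by ring.
  move: (A * x1) h2 => x2; lra.
apply: (@le_trans _ _ (\sum_(0 <= t < q.+1) layer_const A h C0 r t)).
  by rewrite [leRHS]big_ltn // lerDr.
rewrite /layer_const !big_split /= -!mulr_sumr.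
have u0 : 0 < r - 1 by rewrite subr_gt0.
have u1 : 1 <= (r - 1)^-1.
  by rewrite invf_ge1 // lerBlDr; case/andP: r12 => _ /ltW.
have s1 : \sum_(0 <= t < q.+1) (2 * t).+1%:R * h ^+ t <= 2 / (1 - h) ^+ 2.
  by apply: sum_odd_geom_le; rewrite h_lt1 ltW.
have s2 : \sum_(0 <= t < q.+1) (h `^ (r - 1)) ^+ t <= (1 + (- ln h)^-1) / (r - 1).
  by apply: sum_powR_le; rewrite ?h_gt0.
have s3 : \sum_(0 <= t < q.+1) (t < C0 + 4)%N%:R <= (C0 + 4)%:R :> R.
  rewrite -natr_sum ler_nat.
  by apply: leq_trans (sum_ltn_le _ _) _; exact: geq_minr.
move: s1 s2 s3; set x1 := \sum_(0 <= t < q.+1) _ * h ^+ t.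
set x2 := \sum_(_ <= t < _) _ ^+ t; set x3 := \sum_(_ <= t < _) _%:R.
set y1 := 2 / _; set y2 := 1 + _; set y3 := (C0 + 4)%:R; set i1 := (r - 1)^-1 in u1 *.
move=> s1 s2 s3.
have x10 : 0 <= x1 by rewrite sumr_ge0 // => t _; rewrite mulr_ge0 // exprn_ge0 // ltW.
have y10 : 0 <= y1 by exact: le_trans s1.
have y30 : 0 <= y3 by rewrite ler0n.
have B0 : 0 <= 2000 + 300 * A by move: A_ge0; lra.
have p1 : (2000 + 300 * A) * x1 <= (2000 + 300 * A) * y1 * i1.
  rewrite -mulrA ler_wpM2l // (le_trans s1) //.
  by rewrite -[leLHS]mulr1 ler_wpM2l.
have p3 : x3 <= y3 * i1 by rewrite (le_trans s3) // -[leLHS]mulr1 ler_wpM2l.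
have -> : ((2000 + 300 * A) * y1 + 64 * y2 + 80 * y3) * i1 =
  (2000 + 300 * A) * y1 * i1 + 64 * (y2 * i1) + 80 * (y3 * i1) by ring.
move: ((2000 + 300 * A) * x1) ((2000 + 300 * A) * y1 * i1) p1 => z1 z2 p1.
by move: (y2 * i1) (y3 * i1) s2 p3 p1 => z3 z4; lra.
Qed.

End Local.

(** * Stopping times *)

Section Stopping.
Variables (X : finType) (lab : nat -> X -> nat) (q : nat).
Hypothesis lab_nest : forall p p' x y,
  (p <= p')%N -> lab p x = lab p y -> lab p' x = lab p' y.
Variable bad : nat -> X -> bool.
Hypothesis bad_lab : forall p x y, lab p x = lab p y -> bad p x = bad p y.

Definition has_bad x := [exists p : 'I_q, bad p x].

(* The value is [0] also when no level is bad: the cell of [x] is then of level 0. *)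
Definition stop x := (\max_(p < q | bad p x) p)%N.

Lemma stop_max p x : (p < q)%N -> bad p x -> (p <= stop x)%N.
Proof. by move=> pq b; exact: (leq_bigmax_cond (Ordinal pq)). Qed.

Lemma stop_le_pred x : (stop x <= q.-1)%N.
Proof. by apply/bigmax_leqP => p _; have := ltn_ord p; clear; lia. Qed.

Lemma stop_le x : (stop x <= q)%N.
Proof. exact: leq_trans (stop_le_pred x) (leq_pred q). Qed.

Lemma stop_bad x : has_bad x -> (stop x < q)%N /\ bad (stop x) x.
Proof.
move=> /existsP[p0 b0].
have [|p bp e] := @eq_bigmax_cond _ (fun p : 'I_q => bad p x) (fun p => p : nat).
  by apply/card_gt0P; exists p0.
have -> : stop x = p by exact: e.
by split; [exact: ltn_ord|exact: bp].
Qed.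

Lemma stop_leP p x y : lab (stop x) y = lab (stop x) x ->
  (p < q)%N -> bad p y -> (p <= stop x)%N.
Proof.
move=> e pq b; rewrite leqNgt; apply/negP => h.
have : bad p x by rewrite -(bad_lab (x := y)) //; apply: lab_nest e; exact: ltnW.
by move=> /(stop_max pq); rewrite leqNgt h.
Qed.

Lemma has_badN x : ~~ has_bad x -> stop x = 0%N.
Proof.
move=> nb; apply/eqP; rewrite -leqn0; apply/bigmax_leqP => p b.
by case/negP: nb; apply/existsP; exists p.
Qed.

(** The maximal bad cells are disjoint: from the level [stop x] upwards both points have the same
    cells, hence the same bad levels. *)
Lemma stop_atom x y : lab (stop x) y = lab (stop x) x -> stop y = stop x.
Proof.
move=> e; apply/eqP; rewrite eqn_leq; apply/andP; split.
  by apply/bigmax_leqP => p; exact: stop_leP.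
have [b|/has_badN -> //] := boolP (has_bad x).
have [sq bs] := stop_bad b.
by apply: stop_max => //; rewrite (bad_lab e).
Qed.

Lemma has_bad_atom x y : has_bad x -> lab (stop x) y = lab (stop x) x -> has_bad y.
Proof.
move=> /stop_bad[sq bs] e; apply/existsP; exists (Ordinal sq).
by rewrite /= (bad_lab e).
Qed.

Lemma stop_up p x y : lab p x = lab p y -> (stop x < p)%N -> (stop y < p)%N.
Proof.
move=> e h; have p0 : (0 < p)%N by exact: leq_ltn_trans h.
rewrite -(prednK p0) ltnS; apply/bigmax_leqP => p' b.
rewrite -ltnS (prednK p0) ltnNge; apply/negP => pp'.
have : bad p' x by rewrite (bad_lab (y := y)) //; exact: lab_nest e.
by move=> /(stop_max (ltn_ord p')) h'; have := leq_ltn_trans h' h; rewrite ltnNge pp'.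
Qed.

End Stopping.

(** * Weak-type bound for the dyadic maximal function *)

Section WeakType.
Variables (R : realType) (X : finType) (lab : nat -> X -> nat) (q : nat).
Hypothesis lab_nest : forall p p' x y,
  (p <= p')%N -> lab p x = lab p y -> lab p' x = lab p' y.
Hypothesis lab_card : forall p x, (p <= q)%N ->
  \sum_(y | lab p y == lab p x) 1 = 2 ^+ p :> R.
Variable v : X -> R.
Hypothesis v_ge0 : forall x, 0 <= v x.

Definition large (c : R) p x := c * 2 ^+ p < \sum_(y | lab p y == lab p x) v y.

Lemma large_lab c p x y : lab p x = lab p y -> large c p x = large c p y.
Proof. by move=> e; rewrite /large e. Qed.

(** The left-hand set is a disjoint union of maximal cells with mean above [c]; on each of them [c]
    times the length is at most the mass. Summing the means over the points of a cell returns its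
    mass. *)
Lemma maximal_weak_type c x0 :
  c * \sum_(x | (lab q x == lab q x0) && has_bad q (large c) x) 1 <=
  \sum_(x | lab q x == lab q x0) v x.
Proof.
pose s := stop q (large c).
pose O x := (lab q x == lab q x0) && has_bad q (large c) x.
have O_atom x y : O x -> lab (s x) y = lab (s x) x -> O y.
  move=> /andP[/eqP h b] e; rewrite /O (has_bad_atom (@large_lab c) b e) andbT -h.
  by apply/eqP; apply: lab_nest e; exact: stop_le.
have sE x y : lab (s x) y = lab (s x) x -> s y = s x.
  exact: (stop_atom lab_nest (@large_lab c)).
apply: (@le_trans _ _ (\sum_(x | O x)
    \sum_(y | lab (s x) y == lab (s x) x) (2 ^+ s x)^-1 * v y)).
  rewrite mulr_sumr; apply: ler_sum => x /andP[_ /stop_bad[_ b]].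
  by rewrite mulr1 -mulr_sumr mulrC ler_pdivlMr ?pow2_gt0 // ltW.
rewrite (exchange_big_dep O) /=; last by move=> x y Ox /eqP; exact: O_atom.
apply: (@le_trans _ _ (\sum_(y | O y) v y)); last first.
  rewrite big_mkcond [leRHS]big_mkcond /=; apply: ler_sum => y _.
  by rewrite /O; case: (_ == _) => //=; case: ifP.
apply: ler_sum => y Oy.
apply: (@le_trans _ _ (\sum_(x | lab (s y) x == lab (s y) y) (2 ^+ s y)^-1 * v y * 1)).
  rewrite big_mkcond [leRHS]big_mkcond /=; apply: ler_sum => x _.
  case: ifPn => [/andP[Ox /eqP e]|_].
    by rewrite (sE _ _ e) e eqxx mulr1.
  by case: ifP => // _; rewrite mulr1 mulr_ge0 // invr_ge0 ltW // pow2_gt0.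
rewrite -mulr_sumr lab_card ?stop_le // mulrAC mulVf ?mul1r //.
Qed.

(** The threshold is 4 times the mean over the whole cell. If [T = 0] no subcell is large; otherwise
    [T] cancels in the weak-type bound. *)
Lemma stopped_quarter x0 (T : R) :
  T = \sum_(x | lab q x == lab q x0) v x ->
  4 * \sum_(x | (lab q x == lab q x0) && has_bad q (large (4 * (T / 2 ^+ q))) x) 1 <=
  2 ^+ q :> R.
Proof.
move=> TS; have q0 := pow2_gt0 R q.
have T0 : 0 <= T by rewrite TS; exact: sumr_ge0.
have [TE|Tn] := eqVneq T 0.
  rewrite big1 ?mulr0 ?ltW // => x /andP[/eqP e /existsP[p]].
  rewrite /large TE mul0r mulr0 mul0r ltNge => /negP[].
  apply: (@le_trans _ _ T); last by rewrite TE.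
  rewrite TS big_mkcond [leRHS]big_mkcond /=; apply: ler_sum => y _.
  case: ifPn => [/eqP h|_]; last by case: ifP.
  by rewrite -e (@lab_nest p q y x) ?eqxx // ltnW.
have Tp : 0 < T by rewrite lt_neqAle eq_sym Tn.
have := maximal_weak_type (4 * (T / 2 ^+ q)) x0; rewrite -TS.
set N := \sum_(x | _) 1 => h.
have : 4 * N * T <= 2 ^+ q * T.
  by rewrite -ler_pdivrMl // (le_trans _ h) // le_eqVlt; apply/orP; left; apply/eqP;
    field; rewrite gt_eqF.
by rewrite ler_pM2r.
Qed.

End WeakType.

(** * Sparse domination on a finite window *)

Section Domination.
Variables (R : realType) (X : finType) (lab : nat -> X -> nat) (L : nat).

Definition cell p x : {set X} := [set y | lab p y == lab p x]%SET.

(* In a nested family, removing from [S] the smaller members leaves disjoint sets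
   [E_S]; this asks that they fill at least half of [S]. *)
Definition carleson (SS : {set {set X}}) :=
  forall S, S \in SS -> (2 * #|\bigcup_(S' in SS | S' \proper S) S'| <= #|S|)%N.

(** The summand of [sparse_form] for the exponents [1] and [r], where [w] and [g] are already
    moduli. *)
Definition sparse_term (w : X -> R) (g : X -> R) (r : R) (S : {set X}) : R :=
  #|S|%:R * (#|S|%:R^-1 * \sum_(x in S) w x) *
  (#|S|%:R^-1 * \sum_(x in S) g x `^ r) `^ r^-1.

Hypothesis lab_nest : forall p p' x y,
  (p <= p')%N -> lab p x = lab p y -> lab p' x = lab p' y.
Hypothesis card_cell : forall p x, (p <= L)%N -> #|cell p x| = (2 ^ p)%N.
Variable K : nat -> X -> X -> R[i].
Hypothesis K_size : forall j x y, (j + 3 <= L)%N -> cmod (K j x y) <= 2 / 2 ^+ j.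
Hypothesis K_supp : forall j x y, (j + 3 <= L)%N -> K j x y != 0 ->
  lab (j + 3)%N x = lab (j + 3)%N y.
Variables (A h : R) (m0 C0 : nat).
Hypothesis A_ge0 : 0 <= A.
Hypothesis h_gt0 : 0 < h.
Hypothesis h_lt1 : h < 1.
Hypothesis h4 : 2^-1 <= h ^+ 4.
Hypothesis m0_gt0 : (0 < m0)%N.
Hypothesis K_gram : forall j k y y', (j + 3 <= L)%N -> (C0 < k)%N ->
  (j = k /\ y != y') \/ (k + m0 <= j)%N ->
  cmod (gram K j y k y') <= A * (h ^+ 4) ^+ k / 2 ^+ j.
Variables (f : X -> R[i]) (g : X -> R) (r : R).
Let w y := cmod (f y).
Hypothesis g_ge0 : forall x, 0 <= g x.
Hypothesis r12 : 1 < r < 2.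

Local Notation term := (sparse_term w g r).

Definition truncation q k x := \sum_(0 <= j < q - 2 | (k <= j)%N) \sum_y K j x y * f y.

(** Besides the truncations, [U] dominates the means of [w] over all cells around the point: this
    dyadic maximal function will absorb the incomplete block of a general truncation. *)
Definition dominated q x0 (SS : {set {set X}}) (U : X -> R) (B : R) :=
  [/\ forall S, S \in SS -> S \subset cell q x0 /\
        exists p x, (p <= q)%N /\ S = cell p x,
      carleson SS,
      forall x, 0 <= U x,
      forall x, x \in cell q x0 ->
        (forall k, cmod (truncation q k x) <= U x) /\
        (forall p, (p <= q)%N -> \sum_(y in cell p x) w y <= U x * 2 ^+ p) &
      \sum_(x in cell q x0) g x * U x <= B * \sum_(S in SS) term S].

Lemma dominated_cell q x y SS U B :
  lab q y = lab q x -> dominated q x SS U B -> dominated q y SS U B.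
Proof.
by move=> e; rewrite /dominated (_ : cell q y = cell q x) //; apply/setP => z; rewrite !inE e.
Qed.

Let lab_card p x : (p <= L)%N -> \sum_(y | lab p y == lab p x) 1 = 2 ^+ p :> R.
Proof.
move=> pL; rewrite -natrX -(card_cell x pL) -sum1_card natr_sum.
by apply: eq_bigl => y; rewrite inE.
Qed.

Section Step.
Variables (q : nat) (x0 : X).
Hypothesis qL : (q <= L)%N.
Variables W T lam G : R.
Hypothesis WE : W = \sum_(x | lab q x == lab q x0) w x.
Hypothesis TE : T = \sum_(x | lab q x == lab q x0) g x `^ r.
Hypothesis lamE : lam = W / 2 ^+ q.
Hypothesis GE0 : G = (T / 2 ^+ q) `^ r^-1.
Let bad p x := large lab w (4 * (W / 2 ^+ q)) p x ||
  large lab (fun x => g x `^ r) (4 * (T / 2 ^+ q)) p x.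
Let I x := lab q x == lab q x0.
Let s := stop q bad.

Let q0 : 0 < 2 ^+ q :> R. Proof. exact: pow2_gt0. Qed.
Let w_ge0 x : 0 <= w x. Proof. exact: cmod_ge0. Qed.
Let W_ge0 : 0 <= W. Proof. by rewrite WE; exact: sumr_ge0. Qed.
Let T_ge0 : 0 <= T. Proof. by rewrite TE; apply: sumr_ge0 => x _; exact: powR_ge0. Qed.

Let bad_lab p x y : lab p x = lab p y -> bad p x = bad p y.
Proof. by move=> e; rewrite /bad !(large_lab _ _ e). Qed.

Let GE : G `^ r = T / 2 ^+ q.
Proof.
rewrite GE0 -powRrM mulVf ?powRr1 ?divr_ge0 ?(ltW q0) //.
by rewrite gt_eqF //; case/andP: r12 => /(lt_trans ltr01).
Qed.

Let good_le p x : I x -> (p <= q)%N -> (p < q)%N ==> ~~ bad p x ->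
  \sum_(y | lab p y == lab p x) w y <= 4 * lam * 2 ^+ p /\
  \sum_(y | lab p y == lab p x) g y `^ r <= 4 * G `^ r * 2 ^+ p.
Proof.
move=> /eqP Ix; rewrite leq_eqVlt => /orP[/eqP -> _|pq].
  rewrite Ix -WE -TE GE lamE -!mulrA !mulVf ?gt_eqF // !mulr1.
  by move: W_ge0 T_ge0; lra.
by rewrite pq /= /bad negb_or GE lamE => /andP[]; rewrite /large -!leNgt.
Qed.

(** Each of the two averages accounts for at most a quarter of the cell. *)
Let stopped_half : (2 * #|[set x | I x && has_bad q bad x]%SET| <= 2 ^ q)%N.
Proof.
have lc p x : (p <= q)%N -> \sum_(y | lab p y == lab p x) 1 = 2 ^+ p :> R.
  by move=> pq; apply: lab_card; exact: leq_trans qL.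
rewrite -(ler_nat R) natrM natrX -sum1_card natr_sum.
have h1 := stopped_quarter lab_nest lc w_ge0 WE.
have h2 := stopped_quarter lab_nest lc (fun x => powR_ge0 (g x) r) TE.
set N1 := \sum_(x | _) 1 in h1; set N2 := \sum_(x | _) 1 in h2.
have : \sum_(x in [set x | I x && has_bad q bad x]%SET) 1%:R <= N1 + N2.
  rewrite /N1 /N2 big_mkcond [X in _ <= X + _]big_mkcond [X in _ <= _ + X]big_mkcond /=.
  rewrite -big_split /=; apply: ler_sum => x _.
  rewrite inE /I; case: (_ == _) => /=; last by rewrite addr0.
  case: ifPn => [/existsP[p /orP[b|b]]|_]; last by do 2 case: ifP => _; rewrite ?addr0.
    have -> : has_bad q (large lab w (4 * (W / 2 ^+ q))) x by apply/existsP; exists p.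
    by rewrite lerDl; case: ifP.
  have -> : has_bad q (large lab (fun x => g x `^ r) (4 * (T / 2 ^+ q))) x.
    by apply/existsP; exists p.
  by rewrite lerDr; case: ifP.
move: h1 h2; lra.
Qed.

(** The extra [4 lam] bounds the means of [w] over the cells that are not bad, as the domination by
    [U] requires. *)
Lemma step_estimate : exists V : X -> R,
  [/\ forall x, 0 <= V x,
      forall x k, I x -> cmod (\sum_(0 <= j < q - 2 | (k <= j)%N && (s x < j + 3)%N)
         \sum_y K j x y * f y) <= V x &
      \sum_(x | I x) g x * (V x + 4 * lam) <=
        (local_const A h m0 C0 / (r - 1) + 8) * term (cell q x0)].
Proof.
have pL p : (p <= q)%N -> (p <= L)%N by move=> h'; exact: leq_trans qL.
have s_atom x y : I x -> lab (s x) y = lab (s x) x -> s y = s x.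
  by move=> _; exact: stop_atom.
have lam_ge0 : 0 <= lam by rewrite lamE divr_ge0 // ltW.
have G_ge0 : 0 <= G by rewrite GE0 powR_ge0.
have w_good p x : I x -> (s x < p <= q)%N ->
    \sum_(y | lab p y == lab p x) w y <= 4 * lam * 2 ^+ p /\
    \sum_(y | lab p y == lab p x) g y `^ r <= 4 * G `^ r * 2 ^+ p.
  move=> Ix /andP[sp pq]; apply: good_le => //; apply/implyP => pq'.
  by apply/negP => /(stop_max pq'); rewrite leqNgt -/s sp.
have w_atom x : I x -> \sum_(y | lab (s x) y == lab (s x) x) w y <= 8 * lam * 2 ^+ s x.
  (* The parent of a stopped cell is good, with mean at most [4 lam], and twice as long: whence
     [8 lam]. *)
  move=> Ix; have [sq|sq] := ltnP (s x) q.
    apply: (@le_trans _ _ (\sum_(y | lab (s x).+1 y == lab (s x).+1 x) w y)).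
      rewrite big_mkcond [leRHS]big_mkcond /=; apply: ler_sum => y _.
      case: ifPn => [/eqP e|_]; last by case: ifP.
      by rewrite (@lab_nest (s x) _ y x) // eqxx.
    have [h1 _] := w_good (s x).+1 x Ix (introT andP (conj (ltnSn _) sq)).
    apply: le_trans h1 _.
    rewrite (exprS 2 (s x)).
    move: (2 ^+ s x) => u.
    by rewrite le_eqVlt; apply/orP; left; apply/eqP; clear; ring.
  have -> : s x = q by apply/eqP; rewrite eqn_leq sq stop_le.
  have -> : \sum_(y | lab q y == lab q x) w y = W by rewrite (eqP Ix) WE.
  rewrite lamE -!mulrA mulVf ?gt_eqF // mulr1; move: W_ge0; lra.
have w_total : \sum_(x | I x) w x <= lam * 2 ^+ q.
  by rewrite lamE mulfVK ?WE // gt_eqF.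
have g_total : \sum_(x | I x) g x `^ r <= G `^ r * 2 ^+ q.
  by rewrite GE mulfVK ?TE // gt_eqF.
have I_size : \sum_(x | I x) 1 = 2 ^+ q :> R by exact: lab_card.
have [|||||||||V [V0 Vmax Vsum]] := local_estimate (lab := lab) (q := q) (K := K) (A := A) (h := h)
    (m0 := m0) (C0 := C0) (I := I) (s := s) (f := f) (g := g) (lam := lam) (G := G) (r := r)
    lab_nest _ _ _ A_ge0 h_gt0 h_lt1 h4 m0_gt0 _ I_size _ s_atom _ _ lam_ge0 g_ge0
    G_ge0 r12 w_total w_atom _ g_total _.
- by move=> p x pq; apply: lab_card; exact: pL.
- by move=> j x y jq; apply: K_size; exact: pL.
- by move=> j x y jq; apply: K_supp; exact: pL.
- by move=> j k y y' jq; apply: K_gram; exact: pL.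
- by move=> x y /eqP Ix e; rewrite /I -e Ix.
- by move=> x _; exact: stop_le.
- by move=> p x y _ _ _; exact: stop_up.
- by move=> p x Ix hp; have [] := w_good p x Ix hp.
- by move=> p x Ix hp; have [] := w_good p x Ix hp.
exists V; split => //.
have termE : term (cell q x0) = lam * 2 ^+ q * G.
  rewrite /sparse_term card_cell // natrX mulrA mulfV ?gt_eqF // mul1r.
  have e v : \sum_(x in cell q x0) v x = \sum_(x | I x) v x :> R.
    by apply: eq_bigl => x; rewrite inE.
  rewrite !e lamE mulfVK ?gt_eqF // -WE -TE GE0 [2 ^- q * T]mulrC.
  by [].
under eq_bigr do rewrite mulrDr.
rewrite big_split /= termE [leRHS]mulrDl; apply: lerD.
  by move: Vsum; rewrite -[leRHS]mulrA.
rewrite -mulr_suml.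
(* Splitting [g] at height [G] replaces Hölder here, at the price of a factor 2; with [4 lam] this
   gives the constant 8. *)
have hg : \sum_(x | I x) g x <= (2 ^+ q + 2 ^+ q) * G.
  have h1 : \sum_(x | I x) 1 <= 2 ^+ q :> R by rewrite I_size.
  have h2 : \sum_(x | I x) g x `^ r * 1 <= 2 ^+ q * G `^ r.
    by rewrite mulrC; under eq_bigr do rewrite mulr1.
  have := split_height (I := I) (q := q) (G := G) (g := g) (r := r) g_ge0 G_ge0 r12 g_total
    (V := fun=> 1) (fun=> ler01) ltr01 h1 h2.
  rewrite powR1 !mul1r; apply: le_trans.
  by apply: ler_sum => x _; rewrite mulr1.
have := ler_wpM2r (mulr_ge0 (ler0n _ 4) lam_ge0) hg.
by move=> h'; apply: le_trans h' _; rewrite le_eqVlt; apply/orP; left; apply/eqP; ring.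
Qed.

Let B := local_const A h m0 C0 / (r - 1) + 8.
Hypothesis B_ge0 : 0 <= B.
Hypothesis IH : forall p x, (p < q)%N -> exists SS U, dominated p x SS U B.

(** At [x], the scales with [j + 3 > s x] are handled by [V]; the others form a truncation for the
    stopped cell of [x], to which induction applies. The sparse family is the cell together with the
    families of its stopped cells. *)
Lemma step_dominated : exists SS U, dominated q x0 SS U B.
Proof.
have [V [V0 Vmax Vsum]] := step_estimate.
pose O x := I x && has_bad q bad x.
pose PP := [set cell (s x) x | x in O]%SET.
have s_atom x y : lab (s x) y = lab (s x) x -> s y = s x by exact: stop_atom.
have lam_ge0 : 0 <= lam by rewrite lamE divr_ge0 // ltW.
(* The choice is made per stopped cell, not per point, so that all points of the cell share one
   family. *)
have /boolp.choice[SU hSU] : forall P : {set X},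
    exists SU : {set {set X}} * (X -> R), P \in PP ->
    exists x, [/\ O x, P = cell (s x) x & dominated (s x) x SU.1 SU.2 B].
  move=> P; have [/imsetP[x Ox PE]|nP] := boolP (P \in PP); last by exists (finset.set0, w).
  have [sq _] := stop_bad (andP Ox).2.
  by have [SS [U hd]] := IH x sq; exists (SS, U) => _; exists x.
have cell_sub p x : I x -> (p <= q)%N -> cell p x \subset cell q x0.
  move=> /eqP Ix pq; apply/fintype.subsetP => y; rewrite !inE => /eqP e.
  by rewrite -Ix; apply/eqP; apply: lab_nest e.
have PP_O P x : P \in PP -> x \in P -> O x /\ P = cell (s x) x.
  move=> /imsetP[z Oz ->]; rewrite inE => /eqP e.
  have /andP[Iz bz] := Oz; rewrite (s_atom _ _ e); split.
    rewrite /O (has_bad_atom bad_lab bz e) andbT.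
    have := fintype.subsetP (cell_sub _ _ Iz (stop_le q bad z)) x.
    by rewrite !inE; apply; apply/eqP.
  by apply/setP => y; rewrite !inE e.
have PP_eq P P' x : P \in PP -> P' \in PP -> x \in P -> x \in P' -> P = P'.
  by move=> hP hP' xP xP'; rewrite (PP_O _ _ hP xP).2 (PP_O _ _ hP' xP').2.
have SU_sub P S : P \in PP -> S \in (SU P).1 -> S \subset P /\
    exists p x, (p <= q)%N /\ S = cell p x.
  move=> hP hS; have [x [Ox PE [hsub _ _ _ _]]] := hSU P hP.
  have [h1 [p [z [ps SE]]]] := hsub _ hS; rewrite {1}PE; split => //.
  by exists p, z; split => //; apply: leq_trans ps (stop_le _ _ _).
have x_cell p x : x \in cell p x by rewrite inE.
have PP_sub P : P \in PP -> P \subset cell q x0.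
  by move=> /imsetP[z /andP[Iz _] ->]; apply: cell_sub => //; exact: stop_le.
pose SS0 := (\bigcup_(P in PP) (SU P).1)%SET.
exists (cell q x0 |: SS0)%SET.
exists (fun x => (if O x then (SU (cell (s x) x)).2 x else 0) + (V x + 4 * lam)).
have SU_dom x : O x -> dominated (s x) x (SU (cell (s x) x)).1 (SU (cell (s x) x)).2 B.
  move=> Ox; have hP : cell (s x) x \in PP by apply/imsetP; exists x.
  have [z [Oz PE hd]] := hSU _ hP.
  have e : lab (s z) x = lab (s z) z.
    have : x \in cell (s z) z by rewrite -PE inE.
    by rewrite inE => /eqP.
  move: (SU _) hd => su hd.
  by rewrite (s_atom _ _ e); exact: dominated_cell e hd.
split.
- move=> S /setU1P[->|/bigcupP[P hP hS]].
    by split => //; exists q, x0.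
  have [h1 h2] := SU_sub _ _ hP hS; split => //.
  exact: fintype.subset_trans h1 (PP_sub _ hP).
- move=> S /setU1P[->|/bigcupP[P hP hS]].
    (* The smaller members all lie in the stopped set. *)
    rewrite card_cell //; apply: leq_trans stopped_half; rewrite leq_mul2l /=.
    apply: subset_leq_card; apply/bigcupsP => S' /andP[/setU1P[->|/bigcupP[P hP hS]]].
      by rewrite fintype.properxx.
    move=> _; apply/fintype.subsetP => x xS.
    have [sP _] := SU_sub _ _ hP hS.
    by rewrite inE; have [] := PP_O P x hP (fintype.subsetP sP _ xS).
  (* Stopped cells being disjoint, the members strictly inside [S] come from the family of the same
     [P]. *)
  have [x [Ox PE [_ hc _ _ _]]] := hSU P hP.
  apply: leq_trans (hc _ hS); rewrite leq_mul2l /=; apply: subset_leq_card.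
  apply/bigcupsP => S' /andP[hS' pS].
  apply: (finset.bigcup_sup S') => //; rewrite pS andbT.
  have [sP _] := SU_sub _ _ hP hS.
  move: hS' => /setU1P[SE|/bigcupP[P' hP' hS']].
    move: pS; rewrite SE properE => /andP[_ /negP[]].
    exact: fintype.subset_trans sP (PP_sub _ hP).
  have [sP' [p [z [_ SE]]]] := SU_sub _ _ hP' hS'.
  have [y yS] : exists y, y \in S' by exists z; rewrite SE x_cell.
  rewrite (PP_eq P P' y) //; last exact: (fintype.subsetP sP').
  by apply: (fintype.subsetP sP); apply: (fintype.subsetP (proper_sub pS)).
- move=> x; rewrite addr_ge0 ?addr_ge0 ?mulr_ge0 //.
  by case: ifP => // /SU_dom[].
- move=> x; rewrite inE => Ix; split.
    move=> k; rewrite /truncation (bigID (fun j => s x < j + 3)%N) /= addrC.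
    apply: le_trans (cmodD _ _) _; apply: lerD; last first.
      by rewrite -[leLHS]addr0 lerD ?Vmax // mulr_ge0.
    (* These are exactly the scales available in the stopped cell. If no level is bad then [s x = 0]
       and none is left. *)
    have -> : \sum_(0 <= j < q - 2 | (k <= j)%N && ~~ (s x < j + 3)%N)
        \sum_y K j x y * f y = truncation (s x) k x.
      have sq : (s x - 2 <= q - 2)%N by rewrite leq_sub2r // stop_le.
      rewrite /truncation [LHS]big_mkcond [RHS]big_mkcond (@big_cat_nat _ _ _ (s x - 2)%N) //=.
      rewrite [X in _ + X]big_nat [X in _ + X]big1 ?addr0.
        apply: eq_big_nat => j hj; have -> : (s x < j + 3)%N = false by move: hj; clear; lia.
        by rewrite andbT.
      move=> j hj; have -> : (s x < j + 3)%N by move: hj; clear; lia.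
      by rewrite andbF.
    have [Ox|nOx] := boolP (O x).
      have [_ _ _ hd _] := SU_dom _ Ox.
      by have [hk _] := hd x (x_cell (s x) x); exact: hk.
    have -> : s x = 0%N.
      by apply: has_badN; move: nOx; rewrite /O /I Ix.
    by rewrite /truncation big_geq // cmod0.
  move=> p pq.
  have -> : \sum_(y in cell p x) w y = \sum_(y | lab p y == lab p x) w y.
    by apply: eq_bigl => y; rewrite inE.
  (* A good level is paid by [4 lam]; a bad one is at most [s x], where the inductive majorant
     applies. *)
  case: (boolP ((p < q)%N ==> ~~ bad p x)) => [good|].
    have [h1 _] := good_le Ix pq good; apply: le_trans h1 _.
    rewrite ler_wpM2r // addrA lerDr addr_ge0 //.
    by case: ifP => // /SU_dom[].
  rewrite negb_imply negbK => /andP[pq' bp].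
  have Ox : O x.
    by rewrite /O /I Ix /=; apply/existsP; exists (Ordinal pq').
  have [_ _ _ hd _] := SU_dom _ Ox; have [_ hp] := hd x (x_cell (s x) x).
  have := hp p (stop_max pq' bp).
  have -> : \sum_(y in cell p x) w y = \sum_(y | lab p y == lab p x) w y.
    by apply: eq_bigl => y; rewrite inE.
  move=> h1; apply: le_trans h1 _; rewrite Ox ler_wpM2r // lerDl addr_ge0 //.
  by rewrite mulr_ge0.
have sumI v : \sum_(x in cell q x0) v x = \sum_(x | I x) v x :> R.
  by apply: eq_bigl => x; rewrite inE.
rewrite sumI; under eq_bigr do rewrite mulrDr.
rewrite big_split /=.
have notin : cell q x0 \notin SS0.
  apply/negP => /bigcupP[P hP hS]; have [sP _] := SU_sub _ _ hP hS.
  have [z [/andP[Iz bz] PE _]] := hSU _ hP.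
  have [sq _] := stop_bad bz.
  have := subset_leq_card sP; rewrite PE !card_cell //; last first.
    exact: leq_trans (ltnW sq) qL.
  by rewrite leq_exp2l // leqNgt sq.
rewrite big_setU1 //= mulrDr addrC; apply: lerD; first exact: Vsum.
apply: (@le_trans _ _ (\sum_(P in PP) B * \sum_(S in (SU P).1) term S)).
  have -> : \sum_(x | I x) g x * (if O x then (SU (cell (s x) x)).2 x else 0) =
      \sum_(x | O x) g x * (SU (cell (s x) x)).2 x.
    rewrite big_mkcond [RHS]big_mkcond /=; apply: eq_bigr => x _.
    by rewrite /O; case: (I x) => //=; case: ifP => // _; rewrite mulr0.
  rewrite (partition_big (fun x => cell (s x) x) (mem PP)) /=; last first.
    by move=> x Ox; apply/imsetP; exists x.
  apply: ler_sum => P hP; have [z [Oz PE [_ _ U0 _ hsum]]] := hSU _ hP.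
  apply: le_trans hsum; rewrite -PE.
  rewrite [leRHS]big_mkcond [leLHS]big_mkcond /=; apply: ler_sum => x _.
  case: ifPn => [/andP[Ox /eqP e]|_]; last by case: ifP => // _; rewrite mulr_ge0.
  by rewrite e -e x_cell.
rewrite -mulr_sumr ler_wpM2l //.
have -> : \sum_(P in PP) \sum_(S in (SU P).1) term S =
   \sum_(S in SS0) \sum_(P in PP | S \in (SU P).1) term S.
  rewrite (exchange_big_dep (mem SS0)) //= => P S hP hS.
  by apply/bigcupP; exists P.
apply: ler_sum => S /bigcupP[P hP hS].
(* Each member belongs to the family of a single stopped cell. *)
rewrite (big_pred1 P) // => P'; apply/andP/eqP => [[hP' hS']|-> //].
have [sP [p [z [_ SE]]]] := SU_sub _ _ hP hS; have [sP' _] := SU_sub _ _ hP' hS'.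
have zS : z \in S by rewrite SE x_cell.
by apply: (PP_eq _ _ z) => //; [exact: (fintype.subsetP sP')|exact: (fintype.subsetP sP)].
Qed.

End Step.

Lemma local_const_ge0 : 0 <= local_const A h m0 C0.
Proof.
have l0 : 0 <= (- ln h)^-1.
  by rewrite invr_ge0 oppr_ge0 ltW // ln_lt0 // h_gt0.
have y0 : 0 <= 2 / (1 - h) ^+ 2 by rewrite divr_ge0 // sqr_ge0.
have B0 : 0 <= 2000 + 300 * A by move: A_ge0; lra.
have := mulr_ge0 B0 y0; have n0 : 0 <= (C0 + 4)%:R :> R by rewrite ler0n.
rewrite /local_const; set z1 := (2000 + 300 * A) * _ => h1.
set z2 := (- ln h)^-1 in l0 *; set z3 := (C0 + 4)%:R in n0 *.
by apply: mulr_ge0; [exact: ler0n|lra].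
Qed.

Lemma sparse_domination q x0 : (q <= L)%N -> exists SS U,
  dominated q x0 SS U (local_const A h m0 C0 / (r - 1) + 8).
Proof.
elim/ltn_ind: q x0 => q IH x0 qL.
apply: (step_dominated qL (erefl _) (erefl _) (erefl _) (erefl _)).
  rewrite addr_ge0 // divr_ge0 ?local_const_ge0 // subr_ge0 ltW //.
  by case/andP: r12.
by move=> p x pq; apply: IH => //; exact: leq_trans (ltnW pq) qL.
Qed.

End Domination.

(** * The kernels on two shifted dyadic grids *)

Lemma fsbig_seqT (V : nmodType) (T : choiceType) (r : seq T) (F : T -> V) :
  uniq r -> (forall i, i \notin r -> F i = 0) ->
  \sum_(i \in [set: T]%classic) F i = \sum_(i <- r) F i.
Proof.
move=> ur F0; rewrite (fsbigE r) //; last by move=> i _; exact: F0.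
by apply: eq_bigl => i; rewrite in_setT.
Qed.

Section MuKernel.
Variable R : realType.
Implicit Types (a : int -> R[i]).

Lemma mu_sum a j z : mu a j z =
  \sum_(0 <= n < (2 ^ j).+1 | (2 ^ j < 2 * n)%N) (if z == n%:Z then a n%:Z / n%:R else 0).
Proof.
apply: eq_bigr => n _; rewrite /delta.
by case: (z == n%:Z); rewrite ?mulr1 ?mulr0.
Qed.

Lemma mu_nat a j (n : nat) :
  mu a j n%:Z = if (2 ^ j < 2 * n)%N && (n <= 2 ^ j)%N then a n%:Z / n%:R else 0.
Proof.
rewrite mu_sum big_mkcond /=.
rewrite (eq_bigr (fun m : nat => if m == n then
    (if (2 ^ j < 2 * n)%N then a n%:Z / n%:R else 0) else 0)); last first.
  by move=> m _; rewrite eqz_nat eq_sym; case: eqP => [->|_] //; rewrite if_same.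
by rewrite -big_mkcond big_nat1_eq /= ltnS; case: (_ < _)%N; case: (_ <= _)%N.
Qed.

Lemma mu_supp a j z : mu a j z != 0 -> exists n : nat,
  [/\ z = n%:Z, (2 ^ j < 2 * n)%N & (n <= 2 ^ j)%N].
Proof.
case: z => n.
  rewrite mu_nat; case: ifP => [/andP[h1 h2] _|_ /eqP//].
  by exists n.
by rewrite mu_sum big1 ?eqxx.
Qed.

Lemma mu_size a j z : (forall n, cmod (a n) <= 1) -> cmod (mu a j z) <= 2 / 2 ^+ j.
Proof.
move=> ha; have p0 := pow2_gt0 R j.
have [->|/mu_supp[n [-> h1 h2]]] := eqVneq (mu a j z) 0.
  by rewrite cmod0 divr_ge0 // ltW.
rewrite mu_nat h1 h2 /= cmodM cmodV cmod_nat.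
have n0 : 0 < n%:R :> R by rewrite ltr0n; move: h1; case: n {h2} => //; rewrite muln0.
apply: (@le_trans _ _ (1 / n%:R)); first by rewrite ler_wpM2r // invr_ge0 ltW.
rewrite ler_pdivrMr // mulrAC ler_pdivlMr // mul1r.
by rewrite -natrX -natrM ler_nat ltnW.
Qed.

Lemma sum_mu_conv a j (N c : nat) (phi : nat -> R[i]) : (c < N)%N ->
  \sum_(0 <= y < N) mu a j (c%:Z - y%:Z) * phi y =
  \sum_(0 <= n < (2 ^ j).+1 | (2 ^ j < 2 * n)%N)
    (if (n <= c)%N then a n%:Z / n%:R * phi (c - n)%N else 0).
Proof.
move=> cN; under eq_bigr do rewrite mu_sum mulr_suml.
rewrite exchange_big /=; apply: eq_bigr => n _.
have [nc|nc] := leqP n c.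
  rewrite (eq_bigr (fun y => if y == (c - n)%N then a n%:Z / n%:R * phi y else 0)).
    by rewrite -big_mkcond big_nat1_eq /= (leq_ltn_trans (leq_subr _ _) cN).
  move=> y _; have -> : (c%:Z - y%:Z == n%:Z) = (y == c - n)%N.
    by apply/eqP/eqP; lia.
  by case: ifP => _; rewrite ?mul0r.
rewrite big1 // => y _.
have -> : (c%:Z - y%:Z == n%:Z) = false by apply/eqP; lia.
by rewrite mul0r.
Qed.

Lemma sum_mu_corr a j (N y : nat) (phi : int -> R[i]) : (y + 2 ^ j < N)%N ->
  \sum_(0 <= x < N) mu a j (x%:Z - y%:Z) * phi x%:Z =
  \sum_(0 <= n < (2 ^ j).+1 | (2 ^ j < 2 * n)%N) a n%:Z / n%:R * phi (y%:Z + n%:Z).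
Proof.
move=> yN; under eq_bigr do rewrite mu_sum mulr_suml.
rewrite exchange_big /= [LHS]big_nat_cond [RHS]big_nat_cond; apply: eq_bigr => n /andP[/andP[_ hn] _].
rewrite (eq_bigr (fun x : nat => if x == (y + n)%N then a n%:Z / n%:R * phi x%:Z else 0)).
  rewrite -big_mkcond big_nat1_eq /= ifT ?PoszD //.
  by apply: leq_ltn_trans yN; rewrite leq_add2l -ltnS.
move=> x _; have -> : (x%:Z - y%:Z == n%:Z) = (x == y + n)%N.
  by apply/eqP/eqP; lia.
by case: ifP => _; rewrite ?mul0r.
Qed.

Lemma convol_mu a j (psi : int -> R[i]) z :
  convol (mu a j) psi z =
  \sum_(0 <= n < (2 ^ j).+1 | (2 ^ j < 2 * n)%N) a n%:Z / n%:R * psi (z - n%:Z).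
Proof.
rewrite /convol.
have mu0 y : y \notin [seq n%:Z | n <- index_iota 0 (2 ^ j).+1] -> mu a j y = 0.
  move=> h; apply/eqP; apply: contraNT h => /mu_supp[n [-> _ h2]].
  by apply: map_f; rewrite mem_index_iota.
rewrite (fsbig_seqT (r := [seq n%:Z | n <- index_iota 0 (2 ^ j).+1])).
- rewrite big_map [RHS]big_mkcond /= [LHS]big_nat [RHS]big_nat; apply: eq_bigr => n hn.
  rewrite mu_nat; move: hn => /andP[_]; rewrite ltnS => ->; rewrite andbT.
  by case: ifP => _; rewrite ?mul0r.
- by rewrite map_inj_uniq ?iota_uniq // => m n [].
- by move=> y /mu0 ->; rewrite mul0r.
Qed.

(* The point [y] and its image under the support of [mu_j] lie in the same cell. *)
Definition good j y := (y %/ 2 ^ (j + 3) == (y + 2 ^ j) %/ 2 ^ (j + 3))%N.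

(** [P] tells which points this grid serves. The cut-off depends on [j] and [y] only, so a column is
    either zero or a full translate of [mu_j], and nonzero Gram entries remain correlations. *)
Definition mu_kernel a (P : nat -> nat -> bool) j (x y : nat) : R[i] :=
  if P j y && good j y then mu a j (x%:Z - y%:Z) else 0.

Lemma mu_kernel_size a P j x y :
  (forall n, cmod (a n) <= 1) -> cmod (mu_kernel a P j x y) <= 2 / 2 ^+ j.
Proof.
move=> ha; rewrite /mu_kernel; case: ifP => _; first exact: mu_size.
by rewrite cmod0 divr_ge0 // ltW // pow2_gt0.
Qed.

Lemma mu_kernel_supp a P j x y : mu_kernel a P j x y != 0 ->
  (x %/ 2 ^ (j + 3) = y %/ 2 ^ (j + 3))%N.
Proof.
rewrite /mu_kernel; case: ifPn => [/andP[_ /eqP g]|]; last by rewrite eqxx.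
move=> /mu_supp[n [e _ h]]; apply/eqP; rewrite eqn_leq {1}g.
have -> : x = (y + n)%N by lia.
by rewrite !leq_div2r // ?leq_add2l // leq_addr.
Qed.

Lemma good_lt j y L : (j + 3 <= L)%N -> (y < 2 ^ L)%N -> good j y -> (y + 2 ^ j < 2 ^ L)%N.
Proof.
move=> jL yL /eqP g.
have e : (2 ^ L = 2 ^ (L - (j + 3)) * 2 ^ (j + 3))%N by rewrite -expnD subnK.
by rewrite e -ltn_divLR ?expn_gt0 // -g ltn_divLR ?expn_gt0 // -e.
Qed.

(** By [good_lt] a good column fits in the window, so summing over the window gives the full
    correlation. *)
Lemma mu_kernel_gram a P (L j k : nat) (y y' : 'I_(2 ^ L)) : (j + 3 <= L)%N ->
  cmod (gram (fun j (x y : 'I_(2 ^ L)) => mu_kernel a P j x y) j y k y') <=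
  cmod (convol (mu a j) (tilde (mu a k)) (y'%:Z - y%:Z)).
Proof.
move=> jL; rewrite /gram /mu_kernel.
case E : (P j y && good j y); last first.
  by rewrite big1 ?cmod0 ?cmod_ge0 // => x _; rewrite mul0r.
have /andP[_ g] := E.
case: (P k y' && good k y'); last first.
  by rewrite big1 ?cmod0 ?cmod_ge0 // => x _; rewrite conjc0 mulr0.
rewrite -(big_mkord xpredT (fun x : nat => mu a j (x%:Z - y%:Z) * (mu a k (x%:Z - y'%:Z))^*%C)).
rewrite (@sum_mu_corr a j _ _ (fun x => (mu a k (x - y'%:Z))^*%C)) ?good_lt //.
rewrite convol_mu /tilde le_eqVlt; apply/orP; left; apply/eqP; congr cmod.
apply: eq_bigr => n _.
by have -> : - (y'%:Z - y%:Z - n%:Z) = y%:Z + n%:Z - y'%:Z by ring.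
Qed.

End MuKernel.

Lemma card_dyadic_cell (L p : nat) (x : 'I_(2 ^ L)) : (p <= L)%N ->
  #|[set y : 'I_(2 ^ L) | (y %/ 2 ^ p == x %/ 2 ^ p)%N]%SET| = (2 ^ p)%N.
Proof.
move=> pL; set c := (x %/ 2 ^ p)%N; have p0 : (0 < 2 ^ p)%N by rewrite expn_gt0.
have cL : (c.+1 * 2 ^ p <= 2 ^ L)%N.
  have e : (2 ^ L = 2 ^ (L - p) * 2 ^ p)%N by rewrite -expnD subnK.
  by rewrite [leqRHS]e leq_mul2r ltn_divLR // -e ltn_ord orbT.
rewrite -sum1_card.
rewrite (eq_bigl (fun y : 'I_(2 ^ L) => (c * 2 ^ p <= y < c.+1 * 2 ^ p)%N)); last first.
  by move=> y; rewrite inE -leq_divRL // -ltn_divLR // ltnS eqn_leq andbC.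
rewrite -(big_mkord (fun y => c * 2 ^ p <= y < c.+1 * 2 ^ p)%N (fun=> 1%N)).
rewrite -(big_nat_widen 0 (c.+1 * 2 ^ p)%N) //.
rewrite (eq_bigl (fun y => true && (c * 2 ^ p <= y)%N)) //.
rewrite -big_nat_widenl // sum_nat_const_nat muln1 -mulnBl subSnn mul1n //.
Qed.

(** The shift [(4 ^ m - 1) / 3] is about a third or two thirds modulo each cell length. *)
Lemma exists_third m : exists d, (3 * d + 1 = 4 ^ m)%N.
Proof.
elim: m => [|m [d IH]]; first by exists 0%N.
by exists (4 * d + 1)%N; rewrite expnS -IH; lia.
Qed.

Lemma not_good_modn j c : ~~ good j c -> (7 * 2 ^ j <= c %% 2 ^ (j + 3))%N.
Proof.
rewrite /good; apply: contraR; rewrite -ltnNge => h.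
have q0 : (0 < 2 ^ (j + 3))%N by rewrite expn_gt0.
rewrite {2}(divn_eq c (2 ^ (j + 3))) -addnA divnMDl // [X in _ == (_ + X)%N]divn_small ?addn0 //.
have qE : (2 ^ (j + 3) = 8 * 2 ^ j)%N by rewrite expnD mulnC.
by move: h; rewrite qE; lia.
Qed.

(* The two grids are shifted by about a third of each cell, so a point close
   to the right end of its cell in one grid is not so in the other. *)
Lemma good_cover d m j c : (3 * d + 1 = 4 ^ m)%N -> (j + 3 <= 2 * m)%N ->
  good j c || good j (c + d).
Proof.
move=> hd jm; apply/orP; have [|/not_good_modn h1] := boolP (good j c); [by left|right].
apply/negPn/negP => /not_good_modn h2.
set q := (2 ^ (j + 3))%N in h1 h2; set u := (2 ^ j)%N in h1 h2.
have qu : q = (8 * u)%N by rewrite /q /u expnD mulnC.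
have u0 : (0 < u)%N by rewrite expn_gt0.
have q0 : (0 < q)%N by rewrite qu; lia.
have [B hB] : exists B, (4 ^ m = q * B)%N.
  by exists (2 ^ (2 * m - (j + 3)))%N; rewrite /q -expnD subnKC // expnM.
have e1 := divn_eq c q; have e2 := divn_eq d q; have e3 := divn_eq (c + d) q.
have l1 := ltn_pmod c q0; have l2 := ltn_pmod d q0; have l3 := ltn_pmod (c + d) q0.
move: h1 h2 e1 e2 e3 l1 l2 l3.
set c1 := (c %% q)%N; set d1 := (d %% q)%N; set s1 := ((c + d) %% q)%N.
set c2 := (c %/ q)%N; set d2 := (d %/ q)%N; set s2 := ((c + d) %/ q)%N.
move=> h1 h2 e1 e2 e3 l1 l2 l3.
(* [3 * d1 + 1] is divisible by [q], positive, and less than [3 q] since [d1 < q]. *)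
have hd1 : (3 * d1 + 1 = q)%N \/ (3 * d1 + 1 = 2 * q)%N.
  have e : (q * B = 3 * d2 * q + (3 * d1 + 1))%N by rewrite -hB -hd e2; lia.
  have hB3 : (3 * d2 <= B)%N.
    by rewrite -(leq_pmul2r q0) [(B * q)%N]mulnC e leq_addr.
  have e' : ((B - 3 * d2) * q = 3 * d1 + 1)%N.
    by rewrite mulnBl [(B * q)%N]mulnC e addKn.
  move: (B - 3 * d2)%N e' => t e'.
  have ht : (t <= 3)%N by rewrite -(leq_pmul2r q0) e'; lia.
  by case: t ht e' => [|[|[|[|]]]] // _; lia.
have hs : (c1 + d1 = s1)%N \/ (c1 + d1 = s1 + q)%N.
  have : ((c1 + d1) %% q = s1)%N by rewrite /c1 /d1 /s1 modnDm.
  move=> hm; have := divn_eq (c1 + d1) q; rewrite hm; set t := ((c1 + d1) %/ q)%N => e.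
  have ht : (t < 2)%N by rewrite /t ltn_divLR //; move: l1 l2; clear; lia.
  case: t ht e => [|[|]] // _; rewrite ?mul0n ?mul1n ?add0n => ->; [by left|right].
  by rewrite addnC.
(* [c1] and [s1] both lie in the last eighth of [[0, q)], so they cannot differ by about a third or
   two thirds modulo [q]. *)
move: hs hd1; clear -h1 h2 qu u0 l1 l2 l3; lia.
Qed.

(** * Reduction of the truncations to the two grids *)

Section Blocks.
Variables (R : realType) (a : int -> R[i]) (o d m : nat).
Hypothesis d_third : (3 * d + 1 = 4 ^ m)%N.
Local Notation N := (2 ^ (2 * m))%N.

(** Positions in the second grid are shifted by [d]; this grid serves only the points that are not
    good in the first one. *)
Definition shifted_bad (j y : nat) : bool := ~~ good j (y - d).

(** Each source point [c - n] is served by exactly one grid: the first if it is good there,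
    otherwise the second, by [good_cover]. For [n > c] both sides vanish, as [f] is zero to the left
    of the window. *)
Lemma block_split (f : int -> R[i]) (c j : nat) :
  (forall z, z + o%:Z < 0 -> f z = 0) -> (c + d < N)%N -> (j + 3 <= 2 * m)%N ->
  \sum_(0 <= n < (2 ^ j).+1 | (2 ^ j < 2 * n)%N)
     a n%:Z / n%:R * f (c%:Z - o%:Z - n%:Z) =
  \sum_(y < N) mu_kernel a (fun _ _ => true) j c y * f (y%:Z - o%:Z) +
  \sum_(y < N) mu_kernel a shifted_bad j (c + d) y * f (y%:Z - (o + d)%N%:Z).
Proof.
move=> f0 cN jm.
rewrite -(big_mkord xpredT (fun y : nat => mu_kernel a (fun _ _ => true) j c y * f (y%:Z - o%:Z))).
rewrite -(big_mkord xpredT (fun y : nat => mu_kernel a shifted_bad j (c + d) y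
   * f (y%:Z - (o + d)%N%:Z))).
rewrite (eq_bigr (fun y : nat => mu a j (c%:Z - y%:Z) *
   (if good j y then f (y%:Z - o%:Z) else 0))); last first.
  by move=> y _; rewrite /mu_kernel /=; case: ifP => _; rewrite ?mul0r ?mulr0.
rewrite [X in _ = _ + X](eq_bigr (fun y : nat => mu a j ((c + d)%N%:Z - y%:Z) *
   (if shifted_bad j y && good j y then f (y%:Z - (o + d)%N%:Z) else 0))); last first.
  by move=> y _; rewrite /mu_kernel; case: ifP => _; rewrite ?mul0r ?mulr0.
rewrite (sum_mu_conv a j (fun y : nat => if good j y then f (y%:Z - o%:Z) else 0));
  last by lia.
rewrite (sum_mu_conv a j (fun y : nat => if shifted_bad j y && good j y then
  f (y%:Z - (o + d)%N%:Z) else 0)) //.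
rewrite -big_split /=; apply: eq_bigr => n _.
have [nc|nc] := leqP n c; last first.
  rewrite f0; last by lia.
  rewrite mulr0 add0r; case: leqP => // nd; case: ifP => _; last by rewrite mulr0.
  by rewrite f0 ?mulr0 //; lia.
have -> : (n <= c + d)%N by lia.
have e1 : (c - n)%N%:Z - o%:Z = c%:Z - o%:Z - n%:Z by lia.
have e2 : (c + d - n)%N%:Z - (o + d)%N%:Z = c%:Z - o%:Z - n%:Z by lia.
have e3 : (c + d - n)%N = (c - n + d)%N by lia.
rewrite e1 e2 /shifted_bad e3 addnK.
have /orP[g|g] := good_cover (c - n) d_third jm.
  by rewrite g /= mulr0 addr0.
by rewrite g andbT; case: (good j (c - n)); rewrite /= ?mulr0 ?addr0 ?add0r.
Qed.

Lemma sum_blocks (V : nmodType) (F : nat -> V) (k J : nat) : (k <= J)%N ->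
  \sum_((2 ^ k).+1 <= n < (2 ^ J).+1) F n =
  \sum_(0 <= j < J.+1 | (k.+1 <= j)%N) \sum_(0 <= n < (2 ^ j).+1 | (2 ^ j < 2 * n)%N) F n.
Proof.
rewrite [RHS](eq_bigl (fun j => true && (k.+1 <= j)%N)) // -big_nat_widenl //.
elim: J => [|J IH] kJ.
  by move: kJ; rewrite leqn0 => /eqP ->; rewrite !big_geq.
move: kJ; rewrite leq_eqVlt => /orP[/eqP ->|kJ]; first by rewrite !big_geq.
rewrite big_nat_recr //= -IH //.
rewrite (@big_cat_nat _ _ _ (2 ^ J).+1) //=; last by rewrite ltnS leq_exp2l.
  congr (_ + _).
  rewrite [RHS](eq_bigl (fun n => true && ((2 ^ J).+1 <= n)%N)); last first.
    by move=> n; rewrite expnS ltn_pmul2l.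
  by rewrite -big_nat_widenl.
by rewrite ltnS leq_exp2l.
Qed.

End Blocks.

Section Tail.
Variables (R : realType) (a : int -> R[i]) (o d m : nat).
Hypothesis a_le1 : forall n, cmod (a n) <= 1.
Hypothesis d_third : (3 * d + 1 = 4 ^ m)%N.
Hypothesis m2 : (2 <= m)%N.
Local Notation N := (2 ^ (2 * m))%N.

Lemma kernel_abs_le (P : nat -> nat -> bool) (v : 'I_N -> R) (u : R) (c k : nat) :
  (k + 3 <= 2 * m)%N ->
  (forall y, 0 <= v y) ->
  \sum_(y < N | (y %/ 2 ^ (k + 3) == c %/ 2 ^ (k + 3))%N) v y <= u * 2 ^+ (k + 3) ->
  \sum_(y < N) cmod (mu_kernel (fun=> 1 : R[i]) P k c y) * v y <= 16 * u.
Proof.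
move=> km v0 hu; have k0 := pow2_gt0 R k.
apply: (@le_trans _ _ (2 / 2 ^+ k * (u * 2 ^+ (k + 3)))); last first.
  by rewrite exprD le_eqVlt; apply/orP; left; apply/eqP; field; rewrite gt_eqF.
apply: le_trans (ler_wpM2l _ hu); last by rewrite divr_ge0 // ltW.
rewrite mulr_sumr [leRHS]big_mkcond /=; apply: ler_sum => y _.
case: ifPn => [_|ny].
  by rewrite ler_wpM2r // mu_kernel_size // => n; rewrite (cmod_nat R 1).
have -> : mu_kernel (fun=> 1 : R[i]) P k c y = 0.
  by apply/eqP; apply: contraNT ny => /mu_kernel_supp ->.
by rewrite cmod0 mul0r.
Qed.

(** With [2 ^ k] the first power of two that is at least [M], the blocks [j > k] are complete and
    cost [u1 + u2]; the incomplete block [[M, 2 ^ k]] is controlled by means of [|f|] at level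
    [k + 3] and costs [16 (u1 + u2)]. *)
Lemma tail_le (f : int -> R[i]) (c : nat) (u1 u2 : R) (M : nat) :
  (forall z, z + o%:Z < 0 -> f z = 0) -> (c + d < N)%N ->
  (forall k, cmod (\sum_(0 <= j < 2 * m - 2 | (k <= j)%N)
     \sum_(y < N) mu_kernel a (fun _ _ => true) j c y * f (y%:Z - o%:Z)) <= u1) ->
  (forall p, (p <= 2 * m)%N ->
     \sum_(y < N | (y %/ 2 ^ p == c %/ 2 ^ p)%N) cmod (f (y%:Z - o%:Z)) <= u1 * 2 ^+ p) ->
  (forall k, cmod (\sum_(0 <= j < 2 * m - 2 | (k <= j)%N)
     \sum_(y < N) mu_kernel a (shifted_bad d) j (c + d) y * f (y%:Z - (o + d)%N%:Z)) <= u2) ->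
  (forall p, (p <= 2 * m)%N ->
     \sum_(y < N | (y %/ 2 ^ p == (c + d) %/ 2 ^ p)%N) cmod (f (y%:Z - (o + d)%N%:Z))
       <= u2 * 2 ^+ p) ->
  (1 <= M)%N ->
  cmod (\sum_(M <= n < (2 ^ (2 * m - 3)).+1) a n%:Z / n%:R * f (c%:Z - o%:Z - n%:Z)) <=
    17 * (u1 + u2).
Proof.
move=> f0 cN t1 s1 t2 s2 M1; set J := (2 * m - 3)%N.
have J1 : J.+1 = (2 * m - 2)%N by rewrite /J; move: m2; clear; lia.
have u10 : 0 <= u1 by apply: le_trans (t1 0%N); exact: cmod_ge0.
have u20 : 0 <= u2 by apply: le_trans (t2 0%N); exact: cmod_ge0.
have [MJ|MJ] := leqP M (2 ^ J); last first.
  by rewrite big_geq // cmod0 mulr_ge0 // addr_ge0.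
set k := up_log 2 M.
have Mk : (M <= 2 ^ k)%N by exact: up_logP.
have kJ : (k <= J)%N by exact: up_log_min.
have k2 : (2 ^ k < 2 * M)%N.
  case E : k => [|k']; first by rewrite expn0; move: M1; clear; lia.
  rewrite expnS ltn_pmul2l // ltnNge; apply/negP => h.
  by have := up_log_min (isT : (1 < 2)%N) h; rewrite -/k E ltnn.
rewrite (@big_cat_nat _ _ _ (2 ^ k).+1) //=; last by rewrite ltnS leq_exp2l.
  rewrite [17 * _](_ : _ = 16 * (u1 + u2) + (u1 + u2)); last by ring.
  apply: le_trans (cmodD _ _) _; apply: lerD; last first.
    rewrite sum_blocks // J1.
    rewrite [X in cmod X](_ : _ =
      \sum_(0 <= j < 2 * m - 2 | (k.+1 <= j)%N)
        \sum_(y < N) mu_kernel a (fun _ _ => true) j c y * f (y%:Z - o%:Z) +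
      \sum_(0 <= j < 2 * m - 2 | (k.+1 <= j)%N)
        \sum_(y < N) mu_kernel a (shifted_bad d) j (c + d) y * f (y%:Z - (o + d)%N%:Z)).
      by apply: le_trans (cmodD _ _) _; exact: lerD.
    rewrite -big_split /= [LHS]big_nat_cond [RHS]big_nat_cond.
    apply: eq_bigr => j /andP[/andP[_ hj] _].
    by apply: block_split => //; move: hj m2; clear; lia.
  (* The incomplete block is majorized by the full block for [a = 1] acting on [|f|], split over the
     same two grids. *)
  pose fa z : R[i] := (cmod (f z))%:C%C.
  have fa0 z : z + o%:Z < 0 -> fa z = 0 by move=> h; rewrite /fa f0 // cmod0.
  have km : (k + 3 <= 2 * m)%N by move: kJ m2; rewrite /J; clear; lia.
  have := block_split (fun=> 1) d_third fa0 cN km.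
  set S := \sum_(0 <= n < _ | _) _ => hS.
  have SE : S = (\sum_(0 <= n < (2 ^ k).+1 | (2 ^ k < 2 * n)%N)
       cmod (f (c%:Z - o%:Z - n%:Z)) / n%:R)%:C%C.
    rewrite rmorph_sum /=; apply: eq_bigr => n _.
    by rewrite rmorphM /= fmorphV /= rmorph_nat /fa; ring.
  apply: (@le_trans _ _ (cmod S)).
    rewrite SE cmod_real; last first.
      by apply: sumr_ge0 => n _; rewrite divr_ge0 // cmod_ge0.
    apply: le_trans (cmod_sum _ _ _) _.
    rewrite [leRHS]big_mkcond [leRHS](@big_cat_nat _ _ _ M) //=; last exact: leq_trans Mk _.
    rewrite ler_wpDl //.
      apply: sumr_ge0 => n _; case: ifP => // _.
      by rewrite divr_ge0 // cmod_ge0.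
    rewrite !big_nat; apply: ler_sum => n /andP[Mn _].
    have -> : (2 ^ k < 2 * n)%N.
      by apply: leq_trans k2 _; rewrite leq_mul2l.
    rewrite !cmodM cmodV cmod_nat mulrC mulrA ler_wpM2r ?invr_ge0 //.
    by rewrite -[leRHS]mulr1 ler_wpM2l // cmod_ge0.
  rewrite hS mulrDr; apply: le_trans (cmodD _ _) _; apply: lerD.
    apply: le_trans (cmod_sum _ _ _) _.
    apply: le_trans (kernel_abs_le (fun _ _ => true) km _ (s1 _ km)); last first.
      by move=> y; exact: cmod_ge0.
    apply: ler_sum => y _; by rewrite cmodM /fa cmod_real ?cmod_ge0.
  apply: le_trans (cmod_sum _ _ _) _.
  apply: le_trans (kernel_abs_le (shifted_bad d) km _ (s2 _ km)); last first.
    by move=> y; exact: cmod_ge0.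
  apply: ler_sum => y _; by rewrite cmodM /fa cmod_real ?cmod_ge0.
exact: leq_trans Mk _.
Qed.

End Tail.

(** * From the window to the integers *)

Lemma zcard_seq (r : seq int) : uniq r -> zcard [set` r]%classic = size r.
Proof.
move=> ur; rewrite /zcard -sum1_size -[RHS]sum1_size.
rewrite -(@fsbig_finite _ _ addn _ [set` r]%classic (fun=> 1%N)); last exact: finite_seq.
by rewrite -(@fsbig_seq _ _ addn).
Qed.

Section Transfer.
Variables (R : realType) (L o : nat).
Local Notation X := 'I_(2 ^ L).

Definition dlab (p : nat) (x : X) : nat := (x %/ 2 ^ p)%N.

Lemma dlab_nest p p' (x y : X) : (p <= p')%N -> dlab p x = dlab p y -> dlab p' x = dlab p' y.
Proof.
by move=> pp'; rewrite /dlab -(subnKC pp') expnD !divnMA => ->.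
Qed.

Definition embed (i : X) : int := i%:Z - o%:Z.

Lemma embed_inj : injective embed.
Proof. by move=> i j h; apply: val_inj => /=; move: h; rewrite /embed; lia. Qed.

Definition embed_set (S : {set X}) : set int := [set` [seq embed i | i <- enum S]]%classic.

Lemma embed_set_in (S : {set X}) i : (embed i \in [seq embed i | i <- enum S]) = (i \in S).
Proof. by rewrite (mem_map embed_inj) mem_enum. Qed.

Lemma embed_setP (S : {set X}) z : embed_set S z -> exists2 i, i \in S & z = embed i.
Proof. by move=> /mapP[k]; rewrite mem_enum; exists k. Qed.

Lemma embed_set_inj : injective embed_set.
Proof.
move=> S S' e; apply/setP => i; rewrite -!embed_set_in.
have h (T : {set X}) : (embed i \in [seq embed i | i <- enum T]) = `[< embed_set T (embed i) >].
  by apply/idP/asboolP.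
by rewrite !h e.
Qed.

Lemma zcard_embed (S : {set X}) : zcard (embed_set S) = #|S|.
Proof.
by rewrite zcard_seq ?size_map -?cardE // (map_inj_uniq embed_inj) enum_uniq.
Qed.

Lemma sum_embed (V : nmodType) (S : {set X}) (F : int -> V) :
  \sum_(z \in embed_set S) F z = \sum_(i in S) F (embed i).
Proof.
rewrite -(@fsbig_seq _ _ +%R) ?(map_inj_uniq embed_inj) ?enum_uniq //.
by rewrite big_map big_enum.
Qed.

Lemma avg_embed (f : int -> R[i]) (S : {set X}) r :
  avg f (embed_set S) r = (#|S|%:R^-1 * \sum_(i in S) cmod (f (embed i)) `^ r) `^ r^-1.
Proof. by rewrite /avg zcard_embed sum_embed. Qed.

Lemma zinterval_embed_cell p x : (p <= L)%N -> zinterval R (embed_set (cell dlab p x)).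
Proof.
move=> pL; split.
  by exists (embed x); rewrite /embed_set /= embed_set_in inE.
have p0 : (0 < 2 ^ p)%N by rewrite expn_gt0.
pose c := dlab p x.
exists ((c * 2 ^ p)%N%:Z - o%:Z)%:~R, ((c.+1 * 2 ^ p)%N%:Z - 1 - o%:Z)%:~R.
apply/seteqP; split => z /=.
  move=> /embed_setP[k]; rewrite inE /dlab => kc ->; rewrite !ler_int /embed.
  have h1 : (c * 2 ^ p <= k)%N by rewrite -leq_divRL // (eqP kc).
  have h2 : (k < c.+1 * 2 ^ p)%N by rewrite -ltn_divLR // (eqP kc).
  by apply/andP; split; move: h1 h2; clear; lia.
rewrite !ler_int => /andP[h1 h2].
have [n zE] : exists n : nat, z = n%:Z - o%:Z.
  by exists (absz (z + o%:Z)); move: h1; clear; lia.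
have n1 : (c * 2 ^ p <= n)%N by move: h1; rewrite zE; clear; lia.
have n2 : (n < c.+1 * 2 ^ p)%N by move: h2; rewrite zE; clear -p0; lia.
have nL : (n < 2 ^ L)%N.
  apply: leq_trans n2 _.
  have e : (2 ^ L = 2 ^ (L - p) * 2 ^ p)%N by rewrite -expnD subnK.
  by rewrite [leqRHS]e leq_mul2r ltn_divLR // -e ltn_ord orbT.
rewrite (_ : z = embed (Ordinal nL)) // /embed_set /= embed_set_in inE /dlab /= eqn_leq.
by rewrite -ltnS ltn_divLR // n2 leq_divRL.
Qed.

Lemma cell_nested p p' (x x' i : X) : i \in cell dlab p x -> i \in cell dlab p' x' ->
  (p <= p')%N -> cell dlab p x \subset cell dlab p' x'.
Proof.
rewrite !inE => /eqP h1 /eqP h2 pp'; apply/fintype.subsetP => y; rewrite !inE => /eqP h3.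
by rewrite -h2; apply/eqP; apply: (dlab_nest pp'); rewrite h3 h1.
Qed.

(** Take for [E_S] the set [S] minus its smaller members: cells are nested, so these cores are
    disjoint, and they keep at least half of [S]. *)
Lemma carleson_sparse (SS : {set {set X}}) :
  (forall S, S \in SS -> exists p x, (p <= L)%N /\ S = cell dlab p x) ->
  carleson SS -> sparse R (embed_set @` [set` SS])%classic.
Proof.
move=> hSS hc; split.
  by move=> _ [S hS <-]; have [p [x [pL ->]]] := hSS S hS; exact: zinterval_embed_cell.
(* [pre] decodes sets of integers, by which the map [E] is indexed. *)
pose pre (T : set int) : {set X} := [set i | `[< T (embed i) >]]%SET.
have preK (S : {set X}) : pre (embed_set S) = S.
  apply/setP => i; rewrite inE -embed_set_in; apply/asboolP/idP => //.
pose core (S : {set X}) := (S :\: \bigcup_(S' in SS | S' \proper S) S')%SET.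
have core_sub S : core S \subset S by exact: subsetDl.
exists (fun T => embed_set (core (pre T))); split.
- move=> _ [S hS <-]; rewrite preK => z /embed_setP[i hi ->].
  by rewrite /embed_set /= embed_set_in (fintype.subsetP (core_sub S)).
- move=> _ _ [S hS <-] [S' hS' <-]; rewrite !preK => -[z [/embed_setP[i hi ->]]].
  rewrite /embed_set /= embed_set_in => hi'; congr embed_set.
  have aux S1 S2 : S1 \in SS -> S2 \in SS -> i \in core S1 -> i \in core S2 ->
      S1 \subset S2 -> S1 = S2.
    move=> h1 h2 i1 i2 s12; apply/eqP; apply: contraTT i2 => ne.
    rewrite /core inE negb_and negbK; apply/orP; left.
    apply/bigcupP; exists S1; last exact: (fintype.subsetP (core_sub S1)).
    by rewrite h1 /= finset.properEneq ne.
  have iS := fintype.subsetP (core_sub S) _ hi.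
  have iS' := fintype.subsetP (core_sub S') _ hi'.
  have [p [x [pL SE]]] := hSS _ hS; have [p' [x' [pL' SE']]] := hSS _ hS'.
  case: (leqP p p') => [pp'|/ltnW pp'].
    apply: aux => //; rewrite SE SE'.
    by apply: (cell_nested (i := i)) pp'; rewrite -?SE -?SE'.
  apply/esym; apply: aux => //; rewrite SE SE'.
  by apply: (cell_nested (i := i)) pp'; rewrite -?SE -?SE'.
- move=> _ [S hS <-]; rewrite preK !zcard_embed.
  have := hc S hS; set U := (\bigcup_(S' in SS | _) S')%SET => hU.
  have hcard : (#|S| <= #|core S| + #|U|)%N.
    by rewrite /core -(cardsID U S) addnC leq_add2l subset_leq_card // subsetIr.
  have : (#|S| <= 2 * #|core S|)%N by move: hU hcard; clear; lia.
  rewrite -(ler_nat R) natrM; have : 0 <= #|S|%:R :> R by rewrite ler0n.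
  lra.
Qed.

Lemma sparse_sum_le (SS : {set {set X}}) (f g : int -> R[i]) (r : R) :
  (forall S, S \in SS -> exists p x, (p <= L)%N /\ S = cell dlab p x) ->
  carleson SS ->
  ((\sum_(S in SS) sparse_term (fun i => cmod (f (embed i))) (fun i => cmod (g (embed i))) r S)%:E
   <= ereal_sup [set sparse_form SS' 1 r f g | SS' in sparse R]%classic)%E.
Proof.
move=> hSS hc; apply: ereal_sup_ge.
exists (sparse_form (embed_set @` [set` SS])%classic 1 r f g).
  by exists (embed_set @` [set` SS])%classic => //; exact: carleson_sparse.
rewrite /sparse_form.
have -> : (embed_set @` [set` SS])%classic = [set` [seq embed_set S' | S' <- enum SS]]%classic.
  apply/seteqP; split => T /=.
    by move=> [S hS <-]; apply: map_f; rewrite mem_enum.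
  by move=> /mapP[S]; rewrite mem_enum => hS ->; exists S.
rewrite esum_fset; [|exact: finite_seq|]; last first.
  by move=> S _; rewrite lee_fin !mulr_ge0 // powR_ge0.
rewrite -fsbig_seq ?(map_inj_uniq embed_set_inj) ?enum_uniq //.
rewrite big_map big_enum /= sumEFin lee_fin; apply: ler_sum => S _.
rewrite zcard_embed !avg_embed invr1 powRr1; last first.
  by rewrite mulr_ge0 ?invr_ge0 // sumr_ge0 // => i _; exact: powR_ge0.
have -> : \sum_(i in S) cmod (f (embed i)) `^ 1 = \sum_(i in S) cmod (f (embed i)).
  by apply: eq_bigr => i _; rewrite powRr1 // cmod_ge0.
exact: lexx.
Qed.

End Transfer.

(** * The bound for finitely supported functions *)

(** The whole window is the cell of level [L], from which the stopping construction starts. *)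
Lemma grid_domination (R : realType) (a : int -> R[i]) (A h : R) (m0 C0 L o : nat)
    (P : nat -> nat -> bool) (f g : int -> R[i]) (r : R) :
  (forall n, cmod (a n) <= 1) -> 0 <= A -> 0 < h -> h < 1 -> 2^-1 <= h ^+ 4 ->
  (0 < m0)%N ->
  (forall (j k : nat) (z : int), (C0 < k)%N -> (j = k /\ z != 0) \/ (k + m0 <= j)%N ->
     cmod (convol (mu a j) (tilde (mu a k)) z) <= A * (h ^+ 4) ^+ k / 2 ^+ j) ->
  1 < r < 2 ->
  exists U : 'I_(2 ^ L) -> R,
    [/\ forall x, 0 <= U x,
        forall (x : 'I_(2 ^ L)) k, cmod (\sum_(0 <= j < L - 2 | (k <= j)%N)
           \sum_(y < 2 ^ L) mu_kernel a P j x y * f (y%:Z - o%:Z)) <= U x,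
        forall (x : 'I_(2 ^ L)) p, (p <= L)%N ->
          \sum_(y < 2 ^ L | (y %/ 2 ^ p == x %/ 2 ^ p)%N) cmod (f (y%:Z - o%:Z)) <= U x * 2 ^+ p &
        ((\sum_(x < 2 ^ L) cmod (g (x%:Z - o%:Z)) * U x)%:E <=
          (local_const A h m0 C0 / (r - 1) + 8)%:E *
          ereal_sup [set sparse_form SS 1 r f g | SS in sparse R]%classic)%E].
Proof.
move=> ha A0 h0 h1 h4 m00 hgram r12.
pose K (j : nat) (x y : 'I_(2 ^ L)) := mu_kernel a P j x y.
have N0 : (0 < 2 ^ L)%N by rewrite expn_gt0.
pose x0 : 'I_(2 ^ L) := Ordinal N0.
have hK j k y y' : (j + 3 <= L)%N -> (C0 < k)%N ->
    (j = k /\ y != y') \/ (k + m0 <= j)%N -> cmod (gram K j y k y') <= A * (h ^+ 4) ^+ k / 2 ^+ j.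
  move=> jL kC hjk; apply: le_trans (mu_kernel_gram a P k y y' jL) _.
  apply: hgram => //; case: hjk => [[jk yy']|]; [left|by right].
  by split => //; rewrite subr_eq0 eqz_nat (inj_eq val_inj) eq_sym.
have [SS [U [hSS hc U0 Udom Usum]]] :=
  sparse_domination (lab := dlab (L := L)) (L := L) (K := K)
   (g := fun i => cmod (g (embed o i))) (r := r) (A := A) (h := h) (m0 := m0) (C0 := C0)
   (@dlab_nest L) (@card_dyadic_cell L)
   (fun j x y _ => mu_kernel_size P j x y ha)
   (fun j (x y : 'I_(2 ^ L)) _ hn => mu_kernel_supp hn)
   A0 h0 h1 h4 m00 hK (fun i => f (embed o i)) (fun i => cmod_ge0 _) r12 x0 (leqnn L).
have all_cell x : x \in cell (@dlab L) L x0.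
  by rewrite inE /dlab !divn_small // ltn_ord.
exists U; split => //.
- by move=> x k; have [hk _] := Udom x (all_cell x); exact: hk.
- move=> x p pL; have [_ hp] := Udom x (all_cell x); apply: le_trans (hp p pL).
  rewrite le_eqVlt; apply/orP; left; apply/eqP; apply: eq_bigl => y.
  by rewrite inE.
- have B0 : 0 <= local_const A h m0 C0 / (r - 1) + 8.
    rewrite addr_ge0 // divr_ge0 ?local_const_ge0 // subr_ge0 ltW //.
    by case/andP: r12.
  apply: (@le_trans _ _ ((local_const A h m0 C0 / (r - 1) + 8)%:E *
    (\sum_(S in SS) sparse_term (fun i => cmod (f (embed o i)))
       (fun i => cmod (g (embed o i))) r S)%:E)%E).
    rewrite -EFinM lee_fin; apply: le_trans Usum.
    rewrite [leRHS]big_mkcond /=; apply: ler_sum => x _.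
    by rewrite all_cell.
  apply: lee_wpmul2l; first by rewrite lee_fin.
  by apply: sparse_sum_le => // S /hSS[].
Qed.

Lemma tail_sumE (R : realType) (a f : int -> R[i]) (x : int) (M N : nat) :
  (forall n : nat, (M <= n)%N -> f (x - n%:Z) = 0) ->
  tail_sum a f x N = \sum_(N <= n < M) (a n%:Z / n%:R * f (x - n%:Z)).
Proof.
move=> f0; rewrite /tail_sum.
have zero b c : (M <= b)%N -> \sum_(b <= n < c) (a n%:Z / n%:R * f (x - n%:Z)) = 0.
  by move=> Mb; rewrite big_nat big1 // => n /andP[bn _]; rewrite f0 ?mulr0 // (leq_trans Mb).
have const k : (M <= k)%N -> \sum_(N <= n < k) (a n%:Z / n%:R * f (x - n%:Z)) =
    \sum_(N <= n < M) (a n%:Z / n%:R * f (x - n%:Z)).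
  move=> Mk; have [NM|MN] := leqP N M; last by rewrite zero ?(ltnW MN) // big_geq // ltnW.
  by rewrite (@big_cat_nat _ _ _ M) //= (zero M k) // addr0.
apply: (@norm_lim_near_cst _ (R[i]^o) nat (\oo)%classic _
  (\sum_(N <= n < M) (a n%:Z / n%:R * f (x - n%:Z)))
  (fun k : nat => \sum_(N <= n < k) (a n%:Z / n%:R * f (x - n%:Z)))).
by exists M => // k /= Mk; exact: const.
Qed.

Lemma fin_supp_bounded (R : realType) (f : int -> R[i]) : fin_supp f ->
  exists W : nat, forall z, (z + W%:Z < 0) || (W%:Z < z) -> f z = 0.
Proof.
move=> /finite_fsetP[F hF].
exists (\max_(z <- F) absz z)%N => z hz; apply/eqP; apply: contraLR hz => fz.
have zF : z \in F by have : [set` F]%classic z by rewrite -hF.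
have : (absz z <= \max_(z <- F) absz z)%N by exact: leq_bigmax_seq.
by lia.
Qed.

Lemma fsbig_window (V : nmodType) (N o : nat) (F : int -> V) :
  (forall z, (z + o%:Z < 0) || (N%:Z <= z + o%:Z) -> F z = 0) ->
  \sum_(z \in [set: int]%classic) F z = \sum_(i < N) F (i%:Z - o%:Z).
Proof.
move=> F0; rewrite (fsbig_seqT (r := [seq i%:Z - o%:Z | i <- index_iota 0 N])).
- by rewrite big_map big_mkord.
- by rewrite map_inj_uniq ?iota_uniq // => i j h; lia.
- move=> z hz; apply: F0; apply: contraNT hz => h; apply/mapP.
  exists (absz (z + o%:Z)); last by lia.
  by rewrite mem_index_iota; lia.
Qed.

(** Both grids are bounded by the same sparse supremum, whence [34 = 2 * 17]. *)
Lemma Hmax_pairing_le (R : realType) (a f g : int -> R[i]) (A h : R) (m0 C0 : nat) (r : R) :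
  (forall n, cmod (a n) <= 1) -> 0 <= A -> 0 < h -> h < 1 -> 2^-1 <= h ^+ 4 ->
  (0 < m0)%N ->
  (forall (j k : nat) (z : int), (C0 < k)%N -> (j = k /\ z != 0) \/ (k + m0 <= j)%N ->
     cmod (convol (mu a j) (tilde (mu a k)) z) <= A * (h ^+ 4) ^+ k / 2 ^+ j) ->
  1 < r < 2 -> fin_supp f -> fin_supp g ->
  ((cmod (pairing (Hmax a f) g))%:E <=
    (34 * (local_const A h m0 C0 / (r - 1) + 8))%:E *
    ereal_sup [set sparse_form SS 1 r f g | SS in sparse R]%classic)%E.
Proof.
move=> ha A0 h0 h1 h4 m00 hgram r12 /fin_supp_bounded[Wf hf] /fin_supp_bounded[Wg hg].
pose W := (Wf + Wg)%N.
have fW z : (z + W%:Z < 0) || (W%:Z < z) -> f z = 0 by move=> hz; apply: hf; rewrite /W in hz; lia.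
have gW z : (z + W%:Z < 0) || (W%:Z < z) -> g z = 0 by move=> hz; apply: hg; rewrite /W in hz; lia.
(* With this [m] an eighth of the window exceeds [2 W], so every [n > 2 ^ (2 m - 3)] takes a point
   of [[- W, W]] out of the support of [f]. *)
pose m := (W + 2)%N; have [d hd] := exists_third m.
have J_large : (2 * W < 2 ^ (2 * m - 3))%N.
  have -> : (2 * m - 3 = (2 * W).+1)%N by rewrite /m; lia.
  by apply: ltn_trans (ltn_expl _ _); rewrite ?ltnSn.
have NE : (2 ^ (2 * m) = 8 * 2 ^ (2 * m - 3))%N.
  have {1}-> : (2 * m = 3 + (2 * m - 3))%N by rewrite /m; lia.
  by rewrite expnD.
have dE : (3 * d + 1 = 2 ^ (2 * m))%N by rewrite hd expnM.
set N := (2 ^ (2 * m))%N in NE dE *.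
have [U1 [U10 U1t U1s U1g]] := grid_domination (2 * m) W (fun _ _ => true) f g
  ha A0 h0 h1 h4 m00 hgram r12.
have [U2 [U20 U2t U2s U2g]] := grid_domination (2 * m) (W + d) (shifted_bad d) f g
  ha A0 h0 h1 h4 m00 hgram r12.
move: U1g U2g; set B := local_const A h m0 C0 / (r - 1) + 8.
set Sp := ereal_sup _ => U1g U2g.
(* [U2] is extended by 0 so that it can be read at [c + d] before this is known to lie in the
   window. *)
pose u2 n := oapp U2 0 (insub n).
have u2E (i : 'I_N) : u2 i = U2 i by rewrite /u2 valK.
have u20 n : 0 <= u2 n by rewrite /u2; case: insub => //=.
have Hle (c : 'I_N) : (c <= 2 * W)%N ->
    0 <= sup [set cmod (tail_sum a f (c%:Z - W%:Z) M) | M in [set M | (1 <= M)%N]]%classic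
      <= 17 * (U1 c + u2 (c + d)%N).
  move=> cW.
  have cdN : (c + d < N)%N by move: J_large NE dE cW; clear; lia.
  have tl M : (1 <= M)%N -> cmod (tail_sum a f (c%:Z - W%:Z) M) <= 17 * (U1 c + u2 (c + d)%N).
    move=> M1; rewrite (@tail_sumE _ _ _ _ (2 ^ (2 * m - 3)).+1); last first.
      by move=> n hn; apply: fW; move: hn J_large cW; clear; lia.
    have -> : u2 (c + d)%N = U2 (Ordinal cdN) by rewrite -u2E.
    apply: (tail_le (m := m) (d := d)) => //.
    - by rewrite /m; clear; lia.
    - by move=> z hz; apply: fW; rewrite hz.
    - exact: U1s.
    - exact: (U2t (Ordinal cdN)).
    - exact: (U2s (Ordinal cdN)).
  apply/andP; split.
    apply: (@le_trans _ _ (cmod (tail_sum a f (c%:Z - W%:Z) 1))); first exact: cmod_ge0.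
    apply: ub_le_sup; last by exists 1%N.
    by exists (17 * (U1 c + u2 (c + d)%N)) => _ [M M1 <-]; exact: tl.
  apply: ge_sup; first by exists (cmod (tail_sum a f (c%:Z - W%:Z) 1)); exists 1%N.
  by move=> _ [M M1 <-]; exact: tl.
pose G1 := \sum_(x < N) cmod (g (x%:Z - W%:Z)) * U1 x.
pose G2 := \sum_(x < N) cmod (g (x%:Z - (W + d)%N%:Z)) * U2 x.
have main : cmod (pairing (Hmax a f) g) <= 17 * (G1 + G2).
  rewrite /pairing (fsbig_window (N := N) (o := W)); last first.
    move=> z hz; have -> : g z = 0 by apply: gW; move: hz NE J_large; clear; lia.
    by rewrite (rmorph0 (@conjc R)) mulr0.
  apply: le_trans (cmod_sum _ _ _) _.
  apply: (@le_trans _ _ (\sum_(i < N) 17 * (cmod (g (i%:Z - W%:Z)) * U1 i +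
      cmod (g (i%:Z - W%:Z)) * u2 (i + d)%N))).
    apply: ler_sum => i _; rewrite cmodM cmod_conj.
    have [iW|iW] := leqP i (2 * W); last first.
      by rewrite gW ?cmod0 ?mulr0 ?mul0r ?addr0 ?mulr0 //; move: iW; clear; lia.
    have /andP[s0 s1] := Hle i iW.
    rewrite /Hmax cmod_real // -mulrDr mulrCA mulrC.
    by rewrite ler_wpM2l // cmod_ge0.
  rewrite -mulr_sumr ler_wpM2l // big_split /= lerD2l.
  rewrite -(big_mkord xpredT (fun i : nat => cmod (g (i%:Z - W%:Z)) * u2 (i + d)%N)).
  have -> : G2 = \sum_(0 <= n < N) cmod (g (n%:Z - (W + d)%N%:Z)) * u2 n.
    by rewrite big_mkord; apply: eq_bigr => i _; rewrite u2E.
  have dN : (d <= N)%N by move: dE; clear; lia.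
  rewrite [leRHS](@big_cat_nat _ _ _ d) //=.
  rewrite ler_wpDl //; first by apply: sumr_ge0 => n _; rewrite mulr_ge0 ?cmod_ge0.
  (* Position [n] of the first grid is position [n + d] of the second; from [N - d] on, [g]
     vanishes. *)
  rewrite -{2}[d]add0n big_addn [leLHS](@big_cat_nat _ _ _ (N - d)%N) ?leq_subr //=.
  rewrite [X in _ + X]big_nat [X in _ + X]big1 ?addr0; last first.
    move=> i /andP[hi _]; rewrite gW ?cmod0 ?mul0r //.
    by move: hi NE dE J_large; clear; lia.
  apply: ler_sum => n _; rewrite (_ : (n + d)%N%:Z - (W + d)%N%:Z = n%:Z - W%:Z) //.
  by clear; lia.
apply: (@le_trans _ _ (17 * (G1 + G2))%:E); first by rewrite lee_fin.
have B0 : 0 < B.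
  rewrite /B ltr_wpDl // divr_ge0 ?local_const_ge0 // subr_ge0 ltW //.
  by case/andP: r12.
(* For [+oo] the bound is trivial, and [-oo] would contradict the bound on the real number [G1]. *)
move: U1g U2g; rewrite -/G1 -/G2; case: Sp => [s| |].
- rewrite -!EFinM !lee_fin => h2 h3.
  by move: h2 h3; rewrite -[34 * B * s]mulrA; move: (B * s) => Bs; lra.
- by move=> _ _; rewrite gt0_muley ?leey // lte_fin mulr_gt0.
- by move=> h2 _; move: h2; rewrite gt0_muleNy ?lte_fin // leeNy_eq.
Qed.

(** * Choice of the constants *)

Local Open Scope classical_set_scope.

Theorem theorem1p2 (R : realType) (a : int -> R[i])
  (ha : forall n : int, cmod (a n) <= 1)
  (eps C A : R) (heps : 0 < eps) (hC : 1 <= C)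
  (hdiag : forall (j : nat) (x : int), C < j%:R -> x != 0 ->
     cmod (convol (mu a j) (tilde (mu a j)) x) <= A * 2 `^ (- (1 + eps) * j%:R))
  (hoff : forall j k : nat, C < k%:R -> k%:R + C <= j%:R ->
     (linfty_norm (convol (mu a j) (tilde (mu a k))) <=
      (A * 2 `^ (- eps * k%:R - j%:R))%:E)%E) :
  exists C' : R, forall r : R, 1 < r < 2 ->
    (sparse_norm (Hmax a) 1 r <= (C' / (r - 1))%:E)%E.
Proof.
(* [b] replaces the decay rate [2 ^ (- eps)] by one that is at least [1 / 2], and [h] is its fourth
   root. *)
pose b := Num.max (2 `^ (- eps)) (2^-1 : R).
pose h := Num.sqrt (Num.sqrt b).
pose A' := Num.max A 0.
(* An integer above [C], serving both as the threshold for the scales and as the gap [m0] between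
   them. *)
pose C0 := Num.bound C.
have C_lt : C < C0%:R by apply: archi_boundP; exact: le_trans hC.
have C0_gt0 : (0 < C0)%N by rewrite -(ltr_nat R); lra.
have A'_ge0 : 0 <= A' by rewrite le_max lexx orbT.
have b_gt0 : 0 < b by rewrite lt_max invr_gt0 ltr0n orbT.
have b_ge : 2^-1 <= b by rewrite le_max lexx orbT.
have b_lt1 : b < 1.
  rewrite gt_max; apply/andP; split; last by lra.
  rewrite powRN invf_lt1 ?powR_gt0 //.
  have : 1 `^ eps < 2 `^ eps by apply: gt0_ltr_powR; rewrite ?nnegrE ?ltr1n.
  by rewrite powR1.
have h_gt0 : 0 < h by rewrite !sqrtr_gt0.
have h4E : h ^+ 4 = b.
  by rewrite -[4%N]/(2 * 2)%N exprM !sqr_sqrtr ?sqrtr_ge0 // ltW.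
have h_lt1 : h < 1.
  rewrite -(@ltr_pXn2r _ 4) ?nnegrE ?(ltW h_gt0) //.
  by rewrite h4E expr1n.
have eps_le k : 2 `^ (- eps * k%:R) <= b ^+ k.
  rewrite powRrM powR_mulrn ?powR_ge0 //.
  by rewrite lerXn2r ?nnegrE ?powR_ge0 ?(ltW b_gt0) // le_max lexx.
have bound_le (k j : nat) : A * 2 `^ (- eps * k%:R - j%:R) <= A' * b ^+ k / 2 ^+ j.
  rewrite powRB ?pnatr_eq0 ?implybT // powR_mulrn // mulrA.
  rewrite ler_wpM2r ?invr_ge0 ?exprn_ge0 //.
  apply: (@le_trans _ _ (A' * 2 `^ (- eps * k%:R))).
    by rewrite ler_wpM2r ?powR_ge0 // le_max lexx.
  by rewrite ler_wpM2l.
have hgram (j k : nat) (z : int) : (C0 < k)%N -> (j = k /\ z != 0) \/ (k + C0 <= j)%N ->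
    cmod (convol (mu a j) (tilde (mu a k)) z) <= A' * (h ^+ 4) ^+ k / 2 ^+ j.
  move=> Ck; have Ck' : C < k%:R by rewrite (lt_trans C_lt) // ltr_nat.
  rewrite h4E => -[[-> z0]|jk].
    apply: le_trans (hdiag _ _ Ck' z0) _; apply: le_trans (bound_le k k).
    by rewrite (_ : - (1 + eps) * k%:R = - eps * k%:R - k%:R) //; ring.
  apply: le_trans (bound_le k j).
  have jk' : k%:R + C <= j%:R.
    apply: (@le_trans _ _ (k%:R + C0%:R)); first by rewrite lerD2l ltW.
    by rewrite -natrD ler_nat.
  rewrite -lee_fin; apply: le_trans (hoff _ _ Ck' jk').
  by apply: ereal_sup_ubound; exists z.
pose lc := local_const A' h C0 C0.
exists (34 * (lc + 8)) => r r12.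
apply: (@le_trans _ _ (34 * (lc / (r - 1) + 8))%:E).
  apply: ereal_inf_lbound; exists (34 * (lc / (r - 1) + 8)) => // f g ff fg.
  by apply: Hmax_pairing_le => //; rewrite h4E.
have /andP[r1 r2] := r12.
have u0 : 0 < r - 1 by rewrite subr_gt0.
have i1 : 1 <= (r - 1)^-1 by rewrite invf_ge1 // lerBlDr ltW.
rewrite lee_fin -mulrA ler_pM2l // mulrDl lerD2l.
by rewrite -[leLHS]mulr1 ler_pM2l.
Qed.
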